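(* The lattices $\operatorname{Sub}(\mathsf V(R_{01}))$, $\operatorname{Sub}(\mathsf V(R_{02}))$ and $\operatorname{Sub}(\mathsf V(R_{11}))$ have respectively $11$, $11$ and $66$ elements. Their complete lists of elements, with relative bases and lower covers, are given below; an entry ''$n$: $E$ [covers]'' means that row $n$ is the subvariety $\mathsf V(R_{ij})[E]$ and that its lower covers are the rows listed in brackets (row numbers local to each list), distinct rows being distinct varieties. Exactly $5$, $5$ and $18$ of these nodes, respectively, satisfy $\delta$. Subvarieties of $\mathsf V(R_{01})$: 1: $\varnothing$ [2]; 2: $\{\iota_2\}$ [3,4]; 3: $\{\eta\}$ [6]; 4: $\{\nu\}$ [5,6]; 5: $\{\delta\}$ [7]; 6: $\{\eta,\nu\}$ [7,8]; 7: $\{\eta,\delta\}$ [9]; 8: $\{s\}$ [9]; 9: $\{\delta,s\}$ [10]; 10: $\{\chi\}$ [11]; 11: $\{\tau\}$ [none]. Rows satisfying $\delta$: 5, 7, 9, 10, 11. Subvarieties of $\mathsf V(R_{02})$: 1: $\varnothing$ [2]; 2: $\{\gamma_1\}$ [3,4]; 3: $\{\beta\}$ [5]; 4: $\{\nu\}$ [5,6]; 5: $\{\nu,\beta\}$ [7,8]; 6: $\{\delta\}$ [7]; 7: $\{\delta,\beta\}$ [9]; 8: $\{s\}$ [9]; 9: $\{\delta,s\}$ [10]; 10: $\{\chi\}$ [11]; 11: $\{\tau\}$ [none]. Rows satisfying $\delta$: 6, 7, 9, 10, 11. Subvarieties of $\mathsf V(R_{11})$: 1: $\varnothing$ [2];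 2: $\{\mu_2\}$ [3,4]; 3: $\{\lambda\}$ [5]; 4: $\{\iota_2^D\}$ [5,6,8]; 5: $\{\lambda,\iota_2^D\}$ [7,9,12]; 6: $\{\nu_D\}$ [9,13]; 7: $\{\eta_D\}$ [10,11,14]; 8: $\{\iota_2\}$ [12,13]; 9: $\{\lambda,\nu_D\}$ [10,16]; 10: $\{\eta_D,\nu_D\}$ [15,20]; 11: $\{\omega_D\}$ [15,21]; 12: $\{\lambda,\iota_2\}$ [14,16]; 13: $\{\nu_D,\iota_2\}$ [16,17]; 14: $\{\eta_D,\iota_2\}$ [19,20,21]; 15: $\{\omega_D,\nu_D\}$ [22,28]; 16: $\{\lambda,\nu_D,\iota_2\}$ [20,23]; 17: $\{\nu\}$ [18,23]; 18: $\{\delta\}$ [24]; 19: $\{\eta\}$ [25,26]; 20: $\{\eta_D,\nu_D,\iota_2\}$ [25,27,28]; 21: $\{\omega_D,\iota_2\}$ [26,28]; 22: $\{\zeta_D\}$ [29,36]; 23: $\{\lambda,\nu\}$ [24,27]; 24: $\{\lambda,\delta\}$ [31]; 25: $\{\eta,\nu_D\}$ [32,33]; 26: $\{\eta,\omega_D\}$ [33,34]; 27: $\{\eta_D,\nu\}$ [31,32,35]; 28: $\{\omega_D,\nu_D,\iota_2\}$ [33,35,36]; 29: $\{\xi\}$ [30,42]; 30: $\{\beta\}$ [43]; 31: $\{\eta_D,\delta\}$ [37,38]; 32: $\{\eta,\nu\}$ [37,39]; 33: $\{\eta,\omega_D,\nu_D\}$ [39,40]; 34: $\{\omega\}$ [46];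 35: $\{\omega_D,\nu\}$ [38,39,41]; 36: $\{\zeta_D,\iota_2\}$ [40,41,42]; 37: $\{\eta,\delta\}$ [44]; 38: $\{\omega_D,\delta\}$ [44,45]; 39: $\{\eta,\omega_D,\nu\}$ [44,46,47]; 40: $\{\eta,\zeta_D\}$ [47,48]; 41: $\{\zeta_D,\nu\}$ [45,47,49]; 42: $\{\xi,\iota_2\}$ [43,48,49]; 43: $\{\beta,\iota_2\}$ [50,51]; 44: $\{\eta,\omega_D,\delta\}$ [52,53]; 45: $\{\zeta_D,\delta\}$ [53,54]; 46: $\{\omega,\nu_D\}$ [52,59]; 47: $\{\eta,\zeta_D,\nu\}$ [53,55,59]; 48: $\{\eta,\xi\}$ [50,55]; 49: $\{\nu,\xi\}$ [51,54,55]; 50: $\{\eta,\beta\}$ [57]; 51: $\{\nu,\beta\}$ [56,57]; 52: $\{\omega,\delta\}$ [61]; 53: $\{\eta,\zeta_D,\delta\}$ [58,61]; 54: $\{\delta,\xi\}$ [56,58]; 55: $\{\eta,\nu,\xi\}$ [57,58]; 56: $\{\delta,\beta\}$ [60]; 57: $\{\eta,\nu,\beta\}$ [60,63]; 58: $\{\eta,\delta,\xi\}$ [60]; 59: $\{\zeta\}$ [61,63]; 60: $\{\eta,\delta,\beta\}$ [64]; 61: $\{\zeta,\delta\}$ [62,64]; 62: $\{\rho\}$ [65]; 63: $\{s\}$ [64]; 64: $\{\delta,s\}$ [65]; 65: $\{\chi\}$ [66]; 66: $\{\tau\}$ [none]. Rows satisfying $\delta$: 18, 24, 31, 37, 38,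 44, 45, 52, 53, 54, 56, 58, 60, 61, 62, 64, 65, 66.
   Context: Language: two binary operations $+,\cdot$, no constants. $u\preceq v$ abbreviates $u+v\approx v$. $\mathsf V(S)$ is the variety generated by $S$; $\operatorname{Sub}(\mathcal W)$ is the lattice of subvarieties of $\mathcal W$; $\mathcal W[E]$ is the subvariety of $\mathcal W$ defined by adjoining the identities in $E$. Let $M=\{0,c,p,q,a,b\}$ (letters used as elements only in this paragraph) be the commutative semigroup whose only nonzero products are $pb=bp=ab=ba=aq=qa=c$. For $i,j\in\{0,1,2\}$, $R_{ij}$ is the commutative additively idempotent semiring on $M$ with this multiplication whose addition is the join operation of the partial order generated by $a<p<0$, $b<q<0$, $c<0$, together with: the first $i$ elements of the chain $a<p$ lie below $c$, and the first $j$ elements of the chain $b<q$ lie below $c$. Abbreviations: $C(t,u)=t+tu$, $D(t,u)=t+u+tu$, $L(a,b,c,d)=ab+bc+cd$ (all letters in identities are variables). The identities: $\rho: x\preceq xy$; $\eta: z\preceq x+xy+yz$; $\omega: y\preceq x+xy$; $\zeta: z\preceq C(x,y)+zt$; $\lambda: z\preceq D(x,y)+xz$; $\eta_D: z\preceq x+xy+yz+D(t,u)$; $\omega_D: y\preceq C(x,y)+D(t,u)$; $\zeta_D: z\preceq D(x,y)+zt$; $\nu: ad\preceq C(t,u)+L(a,b,c,d)$; $\mu_2: ad\preceq b+c+L(a,b,c,d)$; $\nu_D: ad\preceq L(a,b,c,d)+D(t,u)$; $\delta: ad\preceq L(a,b,c,d)$; $\xi: x^2\approx D(x,y)$; $\beta: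 xz\preceq C(x,y)+C(t,z)$; $s: x^2\approx C(x,y)$; $\chi: x^2\approx xy$; $\tau: x\approx y$; $\iota_2: x_0x_5\preceq x_1+\sum_{j=0}^4x_jx_{j+1}$; $\iota_2^D: x_0x_5\preceq x_1+\sum_{j=0}^4x_jx_{j+1}+D(t,u)$; $\gamma_1: x_0y\preceq x_0+x_2+x_0x_1+x_1x_2+x_2y$. *)

(* Defs.v *)
From mathcomp Require Import all_boot.
From mathcomp Require Import boolp classical_sets functions cardinality.
From Stdlib Require Import Relation_Operators.
From Stdlib Require List.

Set Implicit Arguments.
Unset Strict Implicit.
Unset Printing Implicit Defensive.

Local Open Scope classical_set_scope.

Record algebra : Type := Algebra {
  carrier :> Type;
  add : carrier -> carrier -> carrier;
  mul : carrier -> carrier -> carrier;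
  carrier_nonempty : inhabited carrier }.

Inductive term : Type :=
| Var of nat
| Add of term & term
| Mul of term & term.

Fixpoint eval (A : algebra) (v : nat -> A) (s : term) : A :=
  match s with
  | Var n => v n
  | Add s1 s2 => add (eval v s1) (eval v s2)
  | Mul s1 s2 => mul (eval v s1) (eval v s2)
  end.

Definition identity : Type := (term * term)%type.

Definition holds (A : algebra) (e : identity) : Prop :=
  forall v : nat -> A, eval v e.1 = eval v e.2.

Definition models (E : set identity) : set algebra :=
  [set A | forall e, E e -> holds A e].

Definition variety (W : set algebra) : Prop :=
  exists E : set identity, W = models E.

Definition V (S : algebra) : set algebra := smallest variety [set S].

Definition Subv (W : set algebra) : set (set algebra) :=
  [set U | variety U /\ U `<=` W].

(* The subvariety W[E]. *)
Definition adjoin (W : set algebra) (E : seq identity) : set algebra :=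
  W `&` models [set e | List.In e E].

Definition satisfies (W : set algebra) (e : identity) : Prop :=
  forall A, W A -> holds A e.

Definition lower_cover (W U1 U2 : set algebra) : Prop :=
  [/\ Subv W U1, Subv W U2, U1 `<` U2 &
      forall U, Subv W U -> U1 `<=` U -> U `<=` U2 -> U = U1 \/ U = U2].

Inductive M : Type := m0 | mc | mp | mq | ma | mb.

Definition mulM (x y : M) : M :=
  match x, y with
  | mp, mb | mb, mp | ma, mb | mb, ma | ma, mq | mq, ma => mc
  | _, _ => m0
  end.

Inductive genM (i j : nat) : M -> M -> Prop :=
| gen_ap : genM i j ma mp
| gen_p0 : genM i j mp m0
| gen_bq : genM i j mb mq
| gen_q0 : genM i j mq m0
| gen_c0 : genM i j mc m0
| gen_xc x : List.In x (take i [:: ma; mp]) -> genM i j x mc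
| gen_yc y : List.In y (take j [:: mb; mq]) -> genM i j y mc.

Definition leM (i j : nat) : M -> M -> Prop := clos_refl_trans M (genM i j).

(* A decision procedure for leM, see leMP. *)
Definition leMb (i j : nat) (x y : M) : bool :=
  match x, y with
  | _, m0 | mc, mc | ma, ma | mp, mp | mb, mb | mq, mq => true
  | ma, mp | mb, mq => true
  | ma, mc => 0 < i
  | mp, mc => 1 < i
  | mb, mc => 0 < j
  | mq, mc => 1 < j
  | _, _ => false
  end.

(* Two incomparable elements have c as their join if both lie below c, and 0
   otherwise, see joinM_lub. *)
Definition joinM (i j : nat) (x y : M) : M :=
  if leMb i j x y then y
  else if leMb i j y x then x
  else if leMb i j x mc && leMb i j y mc then mc
  else m0.

Lemma leMP i j x y : leM i j x y <-> leMb i j x y.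
Proof.
split.
  elim=> {x y} [x y [] //|x|x y z _ + _ +].
  - by case: i => [|[|i]] z //= => [[<-|]|[<-|[<-|]]].
  - by case: j => [|[|j]] z //= => [[<-|]|[<-|[<-|]]].
  - by case: x.
  - by case: x; case: y; case: z => //=; case: i => [|[|i]]; case: j => [|[|j]].
have S u w : genM i j u w -> leM i j u w by exact: rt_step.
have T v u w : leM i j u v -> leM i j v w -> leM i j u w by exact: rt_trans.
have ap := S _ _ (gen_ap i j); have p0 := S _ _ (gen_p0 i j).
have bq := S _ _ (gen_bq i j); have q0 := S _ _ (gen_q0 i j).
have c0 := S _ _ (gen_c0 i j).
have a0 := T _ _ _ ap p0; have b0 := T _ _ _ bq q0.
have ac : 0 < i -> leM i j ma mc.
  by move=> i0; apply/S/gen_xc; rewrite -(prednK i0); left.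
have pc : 1 < i -> leM i j mp mc.
  by move=> i1; apply/S/gen_xc; rewrite -(subnK i1) addn2; right; left.
have bc : 0 < j -> leM i j mb mc.
  by move=> j0; apply/S/gen_yc; rewrite -(prednK j0); left.
have qc : 1 < j -> leM i j mq mc.
  by move=> j1; apply/S/gen_yc; rewrite -(subnK j1) addn2; right; left.
by case: x; case: y => //= lexy; try exact: rt_refl; auto.
Qed.

Lemma leM_antisym i j x y : leM i j x y -> leM i j y x -> x = y.
Proof. by rewrite !leMP; case: x; case: y. Qed.

Lemma joinM_lub i j x y :
  [/\ leM i j x (joinM i j x y), leM i j y (joinM i j x y) &
      forall z, leM i j x z -> leM i j y z -> leM i j (joinM i j x y) z].
Proof.
split; last move=> z; rewrite !leMP.
all: case: x; case: y; try case: z.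
all: by rewrite /joinM //=; case: i => [|[|i]]; case: j => [|[|j]].
Qed.

Lemma R_ai_semiring i j :
  [/\ associative (joinM i j), commutative (joinM i j),
      idempotent_op (joinM i j), associative mulM &
      commutative mulM /\ left_distributive mulM (joinM i j)].
Proof.
split; last split; repeat (let v := fresh in move=> v; case: v).
all: by rewrite /joinM //=; case: i => [|[|i]]; case: j => [|[|j]].
Qed.

Definition R (i j : nat) : algebra := Algebra (joinM i j) mulM (inhabits m0).

Declare Scope term_scope.
Delimit Scope term_scope with term.
Local Notation "s + t" := (Add s t) : term_scope.
Local Notation "s * t" := (Mul s t) : term_scope.
Local Notation "s =~ t" := ((s, t) : identity) (at level 70) : term_scope.
Local Notation "s <=~ t" := ((Add s t, t) : identity) (at level 70) : term_scope.
Local Open Scope term_scope.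

Module Letter.
Definition x : term := Var 0.
Definition y : term := Var 1.
Definition z : term := Var 2.
Definition t : term := Var 3.
Definition u : term := Var 4.
Definition a : term := Var 5.
Definition b : term := Var 6.
Definition c : term := Var 7.
Definition d : term := Var 8.
Definition x_ (k : nat) : term := Var (9 + k).
End Letter.
Import Letter.

Definition C (p q : term) : term := p + p * q.
Definition D (p q : term) : term := p + q + p * q.
Definition L (p q r s : term) : term := p * q + q * r + r * s.

Definition id_rho := x <=~ x * y.
Definition id_eta := z <=~ x + x * y + y * z.
Definition id_omega := y <=~ x + x * y.
Definition id_zeta := z <=~ C x y + z * t.
Definition id_lambda := z <=~ D x y + x * z.
Definition id_eta_D := z <=~ x + x * y + y * z + D t u.
Definition id_omega_D := y <=~ C x y + D t u.
Definition id_zeta_D := z <=~ D x y + z * t.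
Definition id_nu := a * d <=~ C t u + L a b c d.
Definition id_mu_2 := a * d <=~ b + c + L a b c d.
Definition id_nu_D := a * d <=~ L a b c d + D t u.
Definition id_delta := a * d <=~ L a b c d.
Definition id_xi := x * x =~ D x y.
Definition id_beta := x * z <=~ C x y + C t z.
Definition id_s := x * x =~ C x y.
Definition id_chi := x * x =~ x * y.
Definition id_tau := x =~ y.

Definition path5 : term :=
  x_ 0 * x_ 1 + x_ 1 * x_ 2 + x_ 2 * x_ 3 + x_ 3 * x_ 4 + x_ 4 * x_ 5.

Definition id_iota_2 := x_ 0 * x_ 5 <=~ x_ 1 + path5.
Definition id_iota_2D := x_ 0 * x_ 5 <=~ x_ 1 + path5 + D t u.
Definition id_gamma_1 :=
  x_ 0 * y <=~ x_ 0 + x_ 2 + x_ 0 * x_ 1 + x_ 1 * x_ 2 + x_ 2 * y.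

(* The n-th entry, counting from 1, consists of the identities E such that
   row n is the subvariety defined by E, and the rows that are its lower
   covers. *)
Definition table01 : seq (seq identity * seq nat) := [::
  ([::], [:: 2]); (* 1 *)
  ([:: id_iota_2], [:: 3; 4]); (* 2 *)
  ([:: id_eta], [:: 6]); (* 3 *)
  ([:: id_nu], [:: 5; 6]); (* 4 *)
  ([:: id_delta], [:: 7]); (* 5 *)
  ([:: id_eta; id_nu], [:: 7; 8]); (* 6 *)
  ([:: id_eta; id_delta], [:: 9]); (* 7 *)
  ([:: id_s], [:: 9]); (* 8 *)
  ([:: id_delta; id_s], [:: 10]); (* 9 *)
  ([:: id_chi], [:: 11]); (* 10 *)
  ([:: id_tau], [::]) (* 11 *)
].

Definition table02 : seq (seq identity * seq nat) := [::
  ([::], [:: 2]); (* 1 *)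
  ([:: id_gamma_1], [:: 3; 4]); (* 2 *)
  ([:: id_beta], [:: 5]); (* 3 *)
  ([:: id_nu], [:: 5; 6]); (* 4 *)
  ([:: id_nu; id_beta], [:: 7; 8]); (* 5 *)
  ([:: id_delta], [:: 7]); (* 6 *)
  ([:: id_delta; id_beta], [:: 9]); (* 7 *)
  ([:: id_s], [:: 9]); (* 8 *)
  ([:: id_delta; id_s], [:: 10]); (* 9 *)
  ([:: id_chi], [:: 11]); (* 10 *)
  ([:: id_tau], [::]) (* 11 *)
].

Definition table11 : seq (seq identity * seq nat) := [::
  ([::], [:: 2]); (* 1 *)
  ([:: id_mu_2], [:: 3; 4]); (* 2 *)
  ([:: id_lambda], [:: 5]); (* 3 *)
  ([:: id_iota_2D], [:: 5; 6; 8]); (* 4 *)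
  ([:: id_lambda; id_iota_2D], [:: 7; 9; 12]); (* 5 *)
  ([:: id_nu_D], [:: 9; 13]); (* 6 *)
  ([:: id_eta_D], [:: 10; 11; 14]); (* 7 *)
  ([:: id_iota_2], [:: 12; 13]); (* 8 *)
  ([:: id_lambda; id_nu_D], [:: 10; 16]); (* 9 *)
  ([:: id_eta_D; id_nu_D], [:: 15; 20]); (* 10 *)
  ([:: id_omega_D], [:: 15; 21]); (* 11 *)
  ([:: id_lambda; id_iota_2], [:: 14; 16]); (* 12 *)
  ([:: id_nu_D; id_iota_2], [:: 16; 17]); (* 13 *)
  ([:: id_eta_D; id_iota_2], [:: 19; 20; 21]); (* 14 *)
  ([:: id_omega_D; id_nu_D], [:: 22; 28]); (* 15 *)
  ([:: id_lambda; id_nu_D; id_iota_2], [:: 20; 23]); (* 16 *)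
  ([:: id_nu], [:: 18; 23]); (* 17 *)
  ([:: id_delta], [:: 24]); (* 18 *)
  ([:: id_eta], [:: 25; 26]); (* 19 *)
  ([:: id_eta_D; id_nu_D; id_iota_2], [:: 25; 27; 28]); (* 20 *)
  ([:: id_omega_D; id_iota_2], [:: 26; 28]); (* 21 *)
  ([:: id_zeta_D], [:: 29; 36]); (* 22 *)
  ([:: id_lambda; id_nu], [:: 24; 27]); (* 23 *)
  ([:: id_lambda; id_delta], [:: 31]); (* 24 *)
  ([:: id_eta; id_nu_D], [:: 32; 33]); (* 25 *)
  ([:: id_eta; id_omega_D], [:: 33; 34]); (* 26 *)
  ([:: id_eta_D; id_nu], [:: 31; 32; 35]); (* 27 *)
  ([:: id_omega_D; id_nu_D; id_iota_2], [:: 33; 35; 36]); (* 28 *)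
  ([:: id_xi], [:: 30; 42]); (* 29 *)
  ([:: id_beta], [:: 43]); (* 30 *)
  ([:: id_eta_D; id_delta], [:: 37; 38]); (* 31 *)
  ([:: id_eta; id_nu], [:: 37; 39]); (* 32 *)
  ([:: id_eta; id_omega_D; id_nu_D], [:: 39; 40]); (* 33 *)
  ([:: id_omega], [:: 46]); (* 34 *)
  ([:: id_omega_D; id_nu], [:: 38; 39; 41]); (* 35 *)
  ([:: id_zeta_D; id_iota_2], [:: 40; 41; 42]); (* 36 *)
  ([:: id_eta; id_delta], [:: 44]); (* 37 *)
  ([:: id_omega_D; id_delta], [:: 44; 45]); (* 38 *)
  ([:: id_eta; id_omega_D; id_nu], [:: 44; 46; 47]); (* 39 *)
  ([:: id_eta; id_zeta_D], [:: 47; 48]); (* 40 *)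
  ([:: id_zeta_D; id_nu], [:: 45; 47; 49]); (* 41 *)
  ([:: id_xi; id_iota_2], [:: 43; 48; 49]); (* 42 *)
  ([:: id_beta; id_iota_2], [:: 50; 51]); (* 43 *)
  ([:: id_eta; id_omega_D; id_delta], [:: 52; 53]); (* 44 *)
  ([:: id_zeta_D; id_delta], [:: 53; 54]); (* 45 *)
  ([:: id_omega; id_nu_D], [:: 52; 59]); (* 46 *)
  ([:: id_eta; id_zeta_D; id_nu], [:: 53; 55; 59]); (* 47 *)
  ([:: id_eta; id_xi], [:: 50; 55]); (* 48 *)
  ([:: id_nu; id_xi], [:: 51; 54; 55]); (* 49 *)
  ([:: id_eta; id_beta], [:: 57]); (* 50 *)
  ([:: id_nu; id_beta], [:: 56; 57]); (* 51 *)
  ([:: id_omega; id_delta], [:: 61]); (* 52 *)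
  ([:: id_eta; id_zeta_D; id_delta], [:: 58; 61]); (* 53 *)
  ([:: id_delta; id_xi], [:: 56; 58]); (* 54 *)
  ([:: id_eta; id_nu; id_xi], [:: 57; 58]); (* 55 *)
  ([:: id_delta; id_beta], [:: 60]); (* 56 *)
  ([:: id_eta; id_nu; id_beta], [:: 60; 63]); (* 57 *)
  ([:: id_eta; id_delta; id_xi], [:: 60]); (* 58 *)
  ([:: id_zeta], [:: 61; 63]); (* 59 *)
  ([:: id_eta; id_delta; id_beta], [:: 64]); (* 60 *)
  ([:: id_zeta; id_delta], [:: 62; 64]); (* 61 *)
  ([:: id_rho], [:: 65]); (* 62 *)
  ([:: id_s], [:: 64]); (* 63 *)
  ([:: id_delta; id_s], [:: 65]); (* 64 *)
  ([:: id_chi], [:: 66]); (* 65 *)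
  ([:: id_tau], [::]) (* 66 *)
].

Definition row_numbers (T : seq (seq identity * seq nat)) : set nat :=
  [set n | 1 <= n <= size T].

Definition basis (T : seq (seq identity * seq nat)) (n : nat) : seq identity :=
  (nth ([::], [::]) T n.-1).1.

Definition covers (T : seq (seq identity * seq nat)) (n : nat) : seq nat :=
  (nth ([::], [::]) T n.-1).2.

Definition row (W : set algebra) (T : seq (seq identity * seq nat)) (n : nat) :
  set algebra := adjoin W (basis T n).

(* T lists every element of Subv W exactly once, with its lower covers. *)
Definition describes_Subv (W : set algebra) (T : seq (seq identity * seq nat)) :
  Prop :=
  set_bij (row_numbers T) (Subv W) (row W T) /\
  forall n m, row_numbers T n -> row_numbers T m ->
    (lower_cover W (row W T m) (row W T n) <-> m \in covers T n).

Definition delta_rows (W : set algebra) (T : seq (seq identity * seq nat)) :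
  set nat := [set n | row_numbers T n /\ satisfies (row W T n) id_delta].

(* Main.v *)
Require Import Defs.
From HB Require Import structures.
From mathcomp Require Import all_boot.
From mathcomp Require Import boolp classical_sets functions cardinality.
From Stdlib Require Import Relation_Operators.

Set Implicit Arguments.
Unset Strict Implicit.
Unset Printing Implicit Defensive.

Local Open Scope classical_set_scope.
Local Open Scope card_scope.

Local Notation add := Defs.add.
Local Notation mul := Defs.mul.

(* Since x^2 is the top of R_ij and xyz = x^2, a term amounts to a graph on the
   letters (its words of length 2) with some marked letters (its words of length
   1), and an identity to inequalities "word below marked graph". An assignment
   of the letters in R_ij not sending the term to 0 is a proper 2-colouring,
   with sides {a, p} and {b, q}, subject to conditions on the marked letters. So
   whether two letters lie on opposite or on equal sides of one component is
   expressed by quantifying over all colourings ([opp], [same]).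

   Folding the graph along colourings shows that, inside V(R_11) or V(R_02),
   every such inequality is equivalent to a set of identities from the list: only
   the position of the word in its component, the sides marked there, and whether
   some component has marks on one side (C) or on both (D) matter. The
   subvarieties then correspond to the sets of listed identities closed under
   consequence; the consequences follow from a few rules, and non-consequences are
   witnessed by subalgebras of a glueing of copies of M, which divides (R_ij)^3.
   Comparing these closed sets with the tables is a finite computation. Finally
   V(R_01) = V(R_11)[beta]. *)

Lemma in_V (S A : algebra) : V S A <-> forall e, holds S e -> holds A e.
Proof.
split=> [VA|SA X [[E ->] SX] e Ee]; last exact/SA/(SX S erefl).
by apply: (VA (models [set e | holds S e])); split=> [|_ -> e //]; exists [set e | holds S e].
Qed.

Lemma V_variety S : variety (V S).
Proof.
exists [set e | holds S e]; apply/seteqP; split=> [A /in_V VA //|A SA].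
exact/in_V.
Qed.

Definition le (A : algebra) (x y : A) : Prop := add x y = y.
Local Notation "x <~ y" := (le x y) (at level 70).

(** Laws shared by all [R i j]. The calculus of words and the folding of graphs rest on them alone;
    what depends on [i] and [j] is proved separately for the two varieties. *)
Record nil_semiring (A : algebra) : Prop := NilSemiring {
  addA : associative (@Defs.add A);
  addC : commutative (@Defs.add A);
  addxx : idempotent_op (@Defs.add A);
  mulA : associative (@Defs.mul A);
  mulC : commutative (@Defs.mul A);
  mulDl : left_distributive (@Defs.mul A) (@Defs.add A);
  sq_const : forall x y : A, mul x x = mul y y;
  sq_top : forall x y : A, add y (mul x x) = mul x x;
  cube_sq : forall x y z : A, mul x (mul y z) = mul x x }.

Lemma nil_semiring_V i j A : V (R i j) A -> nil_semiring A.
Proof.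
have [RA RC RI RmA [RmC RD]] := R_ai_semiring i j.
pose x := Var 0; pose y := Var 1; pose z := Var 2.
move=> /in_V VA; split.
- move=> a b c; apply: (VA (Add x (Add y z), Add (Add x y) z) _ (nth a [:: a; b; c])).
  by move=> v; exact: RA.
- move=> a b; apply: (VA (Add x y, Add y x) _ (nth a [:: a; b])).
  by move=> v; exact: RC.
- move=> a; apply: (VA (Add x x, x) _ (fun=> a)).
  by move=> v; exact: RI.
- move=> a b c; apply: (VA (Mul x (Mul y z), Mul (Mul x y) z) _ (nth a [:: a; b; c])).
  by move=> v; exact: RmA.
- move=> a b; apply: (VA (Mul x y, Mul y x) _ (nth a [:: a; b])).
  by move=> v; exact: RmC.
- move=> a b c.
  apply: (VA (Mul (Add x y) z, Add (Mul x z) (Mul y z)) _ (nth a [:: a; b; c])).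
  by move=> v; exact: RD.
- move=> a b; apply: (VA (Mul x x, Mul y y) _ (nth a [:: a; b])).
  by move=> v /=; case: (v 0); case: (v 1).
- move=> a b; apply: (VA (Add y (Mul x x), Mul x x) _ (nth a [:: a; b])).
  by move=> v /=; case: (v 0); case: (v 1).
- move=> a b c; apply: (VA (Mul x (Mul y z), Mul x x) _ (nth a [:: a; b; c])).
  by move=> v /=; case: (v 0); case: (v 1); case: (v 2).
Qed.

(** * Words and clauses *)

Definition word := seq nat.

Fixpoint words (t : term) : seq word :=
  match t with
  | Var n => [:: [:: n]]
  | Add s t => words s ++ words t
  | Mul s t => [seq u ++ w | u <- words s, w <- words t]
  end.

(* The value at the empty word, which never occurs in [words t], is junk. *)
Fixpoint wval (A : algebra) (v : nat -> A) (w : word) : A :=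
  match w with
  | [::] => v 0
  | n :: w' => if w' is [::] then v n else mul (v n) (wval v w')
  end.

Lemma words_nonempty t w : w \in words t -> w != [::].
Proof.
elim: t w => [n|s IHs t IHt|s IHs t IHt] w /=.
- by rewrite inE => /eqP->.
- by rewrite mem_cat => /orP[/IHs|/IHt].
- by case/allpairsP=> -[u u'] /= [/IHs + _ ->]; case: u.
Qed.

Section Order.
Variables (A : algebra) (HA : nil_semiring A).
Implicit Types (x y z : A) (v : nat -> A).

Lemma le_refl x : x <~ x.
Proof. exact: addxx. Qed.

Lemma le_trans y x z : x <~ y -> y <~ z -> x <~ z.
Proof. by rewrite /le => xy yz; rewrite -yz (addA HA) xy. Qed.

Lemma le_anti x y : x <~ y -> y <~ x -> x = y.
Proof. by rewrite /le => xy yx; rewrite -xy (addC HA) yx. Qed.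

Lemma le_add x y z : add x y <~ z <-> x <~ z /\ y <~ z.
Proof.
rewrite /le; split=> [xyz|[xz yz]]; last by rewrite -(addA HA) yz.
split; rewrite -[in LHS]xyz (addA HA); first by rewrite (addA HA) (addxx HA).
by rewrite (addC HA x) (addA HA) (addxx HA) (addC HA y).
Qed.

Lemma le_sq x y z : mul x x <~ z -> y <~ z.
Proof. by rewrite /le (addC HA) (sq_top HA) => <-; exact: sq_top. Qed.

Lemma le_cube x y z z' : mul x (mul y z) <~ z' -> forall u, u <~ z'.
Proof. by rewrite (cube_sq HA) => /le_sq + u; apply. Qed.

Lemma le_mulC x y z : mul x y <~ z -> mul y x <~ z.
Proof. by rewrite (mulC HA). Qed.

Lemma wval_cat v u w : u != [::] -> w != [::] ->
  wval v (u ++ w) = mul (wval v u) (wval v w).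
Proof.
move=> + w0; elim: u => // n [|m u] IH _; first by case: w w0 {IH}.
rewrite -[LHS]/(mul (v n) (wval v ((m :: u) ++ w))) IH //.
by rewrite -[wval v [:: n, m & u]]/(mul (v n) (wval v (m :: u))) (mulA HA).
Qed.

Lemma wval_long v w x z : 2 < size w -> wval v w <~ z -> x <~ z.
Proof.
by case: w => [|a [|b [|c w]]] //= _ /le_cube; apply.
Qed.

Let mul_add x y r : mul (add x y) r = add (mul x r) (mul y r).
Proof. exact: mulDl. Qed.

(** The extra factor [r] makes the induction work: in the case of a product, the other factor is
    absorbed into it. *)
Lemma eval_mul_le v t r z :
  mul (eval v t) r <~ z <-> forall w, w \in words t -> mul (wval v w) r <~ z.
Proof.
elim: t r => [n|s IHs t IHt|s IHs t IHt] r /=.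
- by split=> [? w|/(_ [:: n])]; [rewrite inE => /eqP->|apply; rewrite inE].
- rewrite mul_add le_add IHs IHt; split=> [[hs ht] w|h].
    by rewrite mem_cat => /orP[/hs|/ht].
  by split=> w wst; apply: h; rewrite mem_cat wst ?orbT.
- rewrite -(mulA HA) IHs; split=> [h w /allpairsP[[u u'] /= [us ut ->]]|h u us].
    have u0 := words_nonempty us; have u0' := words_nonempty ut.
    have := h _ us; rewrite (mulA HA) (mulC HA (wval v u)) -(mulA HA) IHt.
    by move/(_ _ ut) => hu; rewrite wval_cat // (mulC HA (wval v u)) -(mulA HA).
  rewrite (mulA HA) (mulC HA (wval v u)) -(mulA HA) IHt => u' ut.
  have u0 := words_nonempty us; have u0' := words_nonempty ut.
  rewrite (mulA HA) (mulC HA (wval v u')) -wval_cat //.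
  by apply: h; apply/allpairsP; exists (u, u').
Qed.

Lemma eval_le v t z :
  eval v t <~ z <-> forall w, w \in words t -> wval v w <~ z.
Proof.
elim: t => [n|s IHs t IHt|s IHs t IHt] /=.
- by split=> [? w|/(_ [:: n])]; [rewrite inE => /eqP->|apply; rewrite inE].
- rewrite le_add IHs IHt; split=> [[hs ht] w|h].
    by rewrite mem_cat => /orP[/hs|/ht].
  by split=> w wst; apply: h; rewrite mem_cat wst ?orbT.
- rewrite eval_mul_le; split=> [h w /allpairsP[[u u'] /= [us ut ->]]|h u us].
    have u0 := words_nonempty us; have u0' := words_nonempty ut.
    have := h _ us; rewrite (mulC HA) eval_mul_le => /(_ _ ut).
    by move=> hu; rewrite wval_cat // (mulC HA).
  rewrite (mulC HA) eval_mul_le => u' ut.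
  have u0 := words_nonempty us; have u0' := words_nonempty ut.
  rewrite (mulC HA) -wval_cat //.
  by apply: h; apply/allpairsP; exists (u, u').
Qed.

End Order.

(* [(ws, w)] is read as the inequality [w <~ \sum ws]. *)
Definition clause := (seq word * word)%type.

Fixpoint below (A : algebra) (v : nat -> A) (z : A) (ws : seq word) : Prop :=
  if ws is w :: ws' then wval v w <~ z /\ below v z ws' else True.

(** Stated for every upper bound [z] of the premises instead of their sum: an inequality is then
    used like a Horn clause, and an empty list of premises makes sense. *)
Definition sat (A : algebra) (c : clause) : Prop :=
  forall (v : nat -> A) z, below v z c.1 -> wval v c.2 <~ z.

Lemma belowP (A : algebra) (v : nat -> A) z ws :
  below v z ws <-> forall w, w \in ws -> wval v w <~ z.
Proof.
elim: ws => [|w ws IH] /=; first by split.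
rewrite IH; split=> [[hw hws] u|h].
  by rewrite inE => /orP[/eqP->|/hws].
by split=> [|u us]; apply: h; rewrite inE ?eqxx // us orbT.
Qed.

Definition rename (r : nat -> nat) (c : clause) : clause :=
  ([seq map r u | u <- c.1], map r c.2).

Lemma wval_map (A : algebra) (v : nat -> A) r w :
  w != [::] -> wval v (map r w) = wval (v \o r) w.
Proof. by elim: w => //= n [|m w] // IH _; rewrite -IH. Qed.

Lemma sat_rename A r c :
  all (fun u => u != [::]) (c.2 :: c.1) -> sat A c -> sat A (rename r c).
Proof.
case/andP=> w0 ws0 h v z hb; rewrite wval_map //; apply: h.
move/belowP: hb => hb; apply/belowP => u us.
by rewrite -wval_map ?(allP ws0) //; apply/hb/map_f.
Qed.

(** [undup] keeps last occurrences; the two reversals make it keep the first ones, so that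
    [normal_clause] numbers letters by first appearance, premises before conclusion. *)
Definition clause_vars (c : clause) : seq nat :=
  rev (undup (rev (flatten (rcons c.1 c.2)))).

Definition normal_clause (c : clause) : clause :=
  rename (index ^~ (clause_vars c)) c.

Lemma sat_normal_clause A c : all (fun u => u != [::]) (c.2 :: c.1) ->
  sat A (normal_clause c) <-> sat A c.
Proof.
move=> c0; split; last exact: sat_rename.
have E u : u \in rcons c.1 c.2 -> map (nth 0 (clause_vars c) \o index ^~ (clause_vars c)) u = u.
  move=> us; apply: map_id_in => n nu /=; rewrite nth_index // mem_rev mem_undup mem_rev.
  by apply/flattenP; exists u.
move/(@sat_rename A (nth 0 (clause_vars c))).
have -> : rename (nth 0 (clause_vars c)) (normal_clause c) = c.
  rewrite /rename /normal_clause /= -map_comp -!map_comp [RHS]surjective_pairing.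
  rewrite E ?mem_rcons ?inE ?eqxx //.
  congr pair; apply: map_id_in => u us /=; rewrite -map_comp E // mem_rcons inE us orbT //.
apply; move: c0; rewrite /= all_map; case/andP=> + c1; case: c.2 => //= _ _ _.
by apply: sub_all c1 => -[].
Qed.

(** One word of the left side is enough for the listed identities: they are of the form [s + t = t]
    with [s] a single word, or have a square (always the top) or a letter on the left. *)
Definition clause_of (e : identity) : clause :=
  (words e.2, head [::] (words e.1)).

Lemma clause_of_nonempty e :
  all (fun u => u != [::]) ((clause_of e).2 :: (clause_of e).1).
Proof.
have H t : all (fun u => u != [::]) (words t) by apply/allP => u /words_nonempty.
have N t : words t != [::].
  elim: t => //= s; first by case: (words s).
  by case: (words s) => // u s' _ t; case: (words t).
rewrite /= H andbT; have := H e.1; have := N e.1.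
by case: (words e.1) => // u s _ /= /andP[].
Qed.

Section Clauses.
Variables (A : algebra) (HA : nil_semiring A).

Lemma sat_words t w : sat A (words t, w) <-> forall v : nat -> A, wval v w <~ eval v t.
Proof.
split=> [h v|h v z /belowP/(eval_le HA) hz]; last exact: le_trans hz.
by apply: h; apply/belowP/(eval_le HA)/le_refl.
Qed.

Lemma holds_le s t w : words s = [:: w] ->
  holds A (Add s t, t) <-> sat A (normal_clause (clause_of (Add s t, t))).
Proof.
move=> sw; rewrite sat_normal_clause ?clause_of_nonempty // /clause_of /= sw sat_words.
have E (v : nat -> A) : eval v s <~ eval v t <-> wval v w <~ eval v t.
  by rewrite (eval_le HA) sw; split=> [/(_ w)|h u]; [apply; rewrite inE|rewrite inE => /eqP->].
by split=> h v; apply/E/h.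
Qed.

Lemma holds_sq n t :
  holds A (Mul (Var n) (Var n), t) <->
  sat A (normal_clause (clause_of (Mul (Var n) (Var n), t))).
Proof.
rewrite sat_normal_clause ?clause_of_nonempty // /clause_of /= sat_words.
split=> h v; first by rewrite -h; exact: le_refl.
by apply: (le_anti HA (h v)); exact: sq_top.
Qed.

Lemma holds_trivial n m :
  holds A (Var n, Var m) <-> sat A (normal_clause (clause_of (Var n, Var m))).
Proof.
rewrite sat_normal_clause ?clause_of_nonempty // /clause_of /= (sat_words (Var m) [:: n]).
split=> h v /=; first by rewrite -[v n]/(eval v (Var n)) (h v); exact: le_refl.
apply: (le_anti HA); first exact: h.
have [->|nm] := eqVneq n m; first exact: le_refl.
(* Exchanging the values of the two letters gives the reverse inequality. *)
by have := h (fun k => if k == n then v m else v n); rewrite /= eqxx eq_sym (negbTE nm).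
Qed.

End Clauses.

(** * Marked graphs *)

Lemma le_R i j (x y : R i j) : x <~ y <-> leMb i j x y.
Proof.
by case: x; case: y; rewrite /le /= /joinM /=; case: i => [|[|i]]; case: j => [|[|j]].
Qed.

Section Graph.
Variable t : term.

Definition mark (x : nat) : bool := [:: x] \in words t.
Definition edge (x y : nat) : bool :=
  ([:: x; y] \in words t) || ([:: y; x] \in words t).
Definition inner (x : nat) : bool := `[< exists y, edge x y >].
(* An isolated marked letter can always be sent to the product of an edge, so only
   these marks matter. *)
Definition imark (x : nat) : bool := mark x && inner x.
Definition long : bool := has (fun w => 2 < size w) (words t).

Definition colouring (col : nat -> bool) : Prop :=
  forall x y, edge x y -> col x != col y.

Definition graph_le (A : algebra) (v : nat -> A) (z : A) : Prop :=
  (forall x, imark x -> v x <~ z) /\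
  (forall x y, edge x y -> mul (v x) (v y) <~ z).

Definition graph_sat (A : algebra) (w : word) : Prop :=
  forall (v : nat -> A) z, graph_le v z -> wval v w <~ z.

Definition collapses (A : algebra) : Prop :=
  forall (v : nat -> A) z, graph_le v z -> forall x, x <~ z.

Lemma edgeC x y : edge x y = edge y x.
Proof. by rewrite /edge orbC. Qed.

Lemma edge_inner x y : edge x y -> inner x.
Proof. by move=> xy; apply/asboolP; exists y. Qed.

Lemma edge_innerr x y : edge x y -> inner y.
Proof. by rewrite edgeC => /edge_inner. Qed.

Lemma innerP x : inner x -> exists y, edge x y.
Proof. by move/asboolP. Qed.

Hypothesis short : ~~ long.
Variables x0 y0 : nat.
Hypothesis xy0 : edge x0 y0.

Section NilSemiring.
Variables (A : algebra) (HA : nil_semiring A).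
Implicit Types (v : nat -> A) (z : A).

Lemma below_graph_le v z : below v z (words t) -> graph_le v z.
Proof.
move/belowP => h; split=> [x /andP[xt _]|x y /orP[] /h //].
  exact: (h [:: x] xt).
exact: le_mulC.
Qed.

Lemma graph_le_below v z : graph_le v z ->
  (forall x, ~~ inner x -> mark x -> v x <~ z) -> below v z (words t).
Proof.
move=> [hm he] ho; apply/belowP => w wt.
have := words_nonempty wt; have := hasPn short _ wt.
case: w wt => [|x [|y [|]]] //= wt _ _.
  have [xi|xi] := boolP (inner x); last exact: ho.
  by apply: hm; rewrite /imark xi andbT.
by apply: he; rewrite /edge wt.
Qed.

Let fill v x := if inner x then v x else mul (v x0) (v y0).

Lemma graph_le_eq v v' z :
  (forall x, inner x -> v' x = v x) -> graph_le v z -> graph_le v' z.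
Proof.
move=> E [hm he]; split=> [x xm|x y xy].
  by rewrite E; [exact: hm|case/andP: xm].
by rewrite !E; [exact: he|exact: edge_innerr xy|exact: edge_inner xy].
Qed.

Lemma fill_below v z : graph_le v z -> below (fill v) z (words t).
Proof.
move=> h; apply: graph_le_below.
  by apply: graph_le_eq h => x; rewrite /fill => ->.
by move=> x /negbTE xi _; rewrite /fill xi; case: h => _; apply.
Qed.

Lemma eq_wval v v' w : w != [::] -> {in w, v =1 v'} -> wval v w = wval v' w.
Proof.
elim: w => //= n [|m w] IH _ h; first by rewrite h ?inE.
by rewrite h ?inE ?eqxx // IH // => k kw; rewrite h // inE kw orbT.
Qed.

(** Letters on no edge are given the product along the edge [xy0], which every bound of the graph
    dominates, so their marks hold automatically. *)
Lemma graph_satE w : w != [::] -> all inner w ->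
  sat A (words t, w) <-> graph_sat A w.
Proof.
move=> w0 wi; split=> h v z hz; last exact/h/below_graph_le.
rewrite (@eq_wval _ (fill v)) //; first exact/h/fill_below.
by move=> x xw; rewrite /fill (allP wi).
Qed.

Lemma collapses_sat w : collapses A -> sat A (words t, w).
Proof. by move=> h v z /below_graph_le /h; apply. Qed.

(** In each case the word can be raised to an arbitrary element without violating the graph: a long
    word or a square is the top, an isolated unmarked letter is free, and an isolated letter filled
    with a product turns the word into a product of three. *)
Lemma collapsesE w :
  [\/ 2 < size w, exists x, w = [:: x; x],
      exists2 x, w = [:: x] & ~~ inner x && ~~ mark x |
      exists x y, w = [:: x; y] /\ ~~ (inner x && inner y)] ->
  sat A (words t, w) <-> collapses A.
Proof.
move=> hw; split=> [h v z hz|]; last exact: collapses_sat.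
case: hw => [sw|[x wE]|[x wE /andP[xi xm]]|[x [y [wE xyi]]]].
- by move=> u; have := h _ _ (fill_below hz); exact: wval_long.
- by move=> u; have := h _ _ (fill_below hz); rewrite wE /= => /(le_sq HA).
- move=> u; have := h (fun n => if n == x then u else fill v n) z.
  rewrite wE /= eqxx; apply; apply: graph_le_below.
    apply: graph_le_eq hz => n ni; rewrite /fill ni.
    by case: eqP => // nx; rewrite -nx ni in xi.
  move=> n ni nm; case: eqP => [nx|_]; first by rewrite -nx nm in xm.
  by rewrite /fill (negbTE ni); case: hz => _; apply.
- have := h _ _ (fill_below hz); rewrite wE /= /fill.
  move: xyi; rewrite negb_and => /orP[/negbTE->|/negbTE->].
    by rewrite (mulC HA) => /(le_cube HA).
  by move/(le_cube HA).
Qed.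

(** The folding step: a substitution [s] carrying marks and edges into the premises of [c]
    specialises the graph inequality to [c]. As [col] is proper, each edge is examined in one
    direction only, from colour [true] to [false]. *)
Lemma subst_sat (col : nat -> bool) (s : nat -> nat) w (c : clause) :
  colouring col -> w != [::] ->
  (forall x, imark x -> [:: s x] \in c.1) ->
  (forall x y, edge x y -> col x -> ~~ col y ->
     ([:: s x; s y] \in c.1) || ([:: s y; s x] \in c.1)) ->
  (forall v, wval v (map s w) = wval v c.2) ->
  graph_sat A w -> sat A c.
Proof.
move=> hc w0 hm he hw h v z /belowP hb; rewrite -hw wval_map //; apply: h.
have E x y : edge x y -> col x -> ~~ col y ->
    mul (v (s x)) (v (s y)) <~ z /\ mul (v (s y)) (v (s x)) <~ z.
  move=> xy cx cy; case/orP: (he _ _ xy cx cy) => /hb /= h1.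
    by split=> //; apply: le_mulC.
  by split=> //; apply: le_mulC.
split=> [x /hm /hb //|x y xy /=]; have := hc _ _ xy.
case cx: (col x); case cy: (col y) => //= _.
  by case: (E x y); rewrite ?cx ?cy.
by case: (E y x); rewrite ?cx ?cy // edgeC.
Qed.

Lemma subst_collapses (col : nat -> bool) (s : nat -> nat) ws x :
  colouring col ->
  (forall x, imark x -> [:: s x] \in ws) ->
  (forall x y, edge x y -> col x -> ~~ col y ->
     ([:: s x; s y] \in ws) || ([:: s y; s x] \in ws)) ->
  collapses A -> sat A (ws, [:: x; x]).
Proof.
move=> hc hm he h.
apply: (@subst_sat col s [:: 0; 0]) => // [v|v z /h]; last exact.
exact: sq_const.
Qed.

End NilSemiring.

Lemma flip_colouring (p : pred nat) col : colouring col ->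
  (forall x y, edge x y -> p x = p y) ->
  colouring (fun u => if p u then ~~ col u else col u).
Proof.
move=> hc hp x y xy; rewrite (hp x y) //; case: ifP; have := hc _ _ xy.
  by case: (col x); case: (col y).
by [].
Qed.

(** Opposition in all colourings forces a path of odd length: if [z] were unreachable from [x],
    flipping the component of [x] would give the two letters equal colours. The induction then
    advances two edges at a time, through the vertices opposite to [x]. *)
Lemma connected_ind (Q : nat -> Prop) x z col0 :
  colouring col0 -> (forall col, colouring col -> col x != col z) ->
  (forall u, edge x u -> Q u) ->
  (forall y u u', Q y -> edge y u -> edge u u' -> col0 u = col0 x -> Q u') -> Q z.
Proof.
move=> hc0 hxz Q1 Q3.
pose reach := clos_refl_trans_n1 nat edge x.
have reachP u : reach u -> if col0 u == col0 x then u = x \/ exists2 y, Q y & edge y u else Q u.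
  elim=> {u} [|u u' uu' _]; first by rewrite eqxx; left.
  have := hc0 _ _ uu'; have [uE|uE] := eqVneq (col0 u) (col0 x).
    rewrite -uE eq_sym => /negbTE-> [ux|[y Qy yu]]; first by apply: Q1; rewrite -ux.
    exact: Q3 Qy yu uu' uE.
  move=> uu'c Qu.
  have -> : col0 u' == col0 x by move: uE uu'c; case: (col0 u); case: (col0 u'); case: (col0 x).
  by right; exists u.
have [rz|nrz] := pselect (reach z).
  by have := reachP _ rz; rewrite eq_sym (negbTE (hxz _ hc0)).
have hp u u' : edge u u' -> `[< reach u >] = `[< reach u' >].
  move=> uu'; apply: asbool_equiv_eq; split=> r; first exact: rtn1_trans r.
  by apply: rtn1_trans r; rewrite edgeC.
have := hxz _ (flip_colouring hc0 hp).
have rx : reach x by exact: rtn1_refl.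
by rewrite asboolT // asboolF //; have := hxz _ hc0; case: (col0 x); case: (col0 z).
Qed.

(** In [R i j] only the bound [mc] has to be examined: [m0] is the top, and any other bound
    dominates the product along [xy0], hence equals [mc] and forces every edge to have product
    [mc]. *)
Lemma valid_sat i j A w : w != [::] -> V (R i j) A ->
  (forall v : nat -> R i j,
     (forall x, imark x -> leMb i j (v x) mc) ->
     (forall x y, edge x y -> mulM (v x) (v y) = mc) ->
     leMb i j (wval v w) mc) ->
  sat A (words t, w).
Proof.
move=> w0 VA h.
have [s sw] : exists s, words s = [:: w].
  elim: w w0 {h} => // n [|m w] IH _; first by exists (Var n).
  by have [//|s sE] := IH; exists (Mul (Var n) s); rewrite /= sE.
have HA := nil_semiring_V VA.
have HR : nil_semiring (R i j) by apply: (@nil_semiring_V i j); apply/in_V.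
have EB (B : algebra) (HB : nil_semiring B) :
    holds B (Add s t, t) <-> sat B (words t, w).
  by rewrite (holds_le HB t sw) sat_normal_clause ?clause_of_nonempty // /clause_of /= sw.
apply/(EB _ HA); move/in_V: VA; apply; apply/(EB _ HR).
move=> v z /(below_graph_le HR) [hm he].
have [->|z0] := pselect (z = m0); first by apply/le_R; case: (wval v w).
have zE : z = mc.
  move/le_R: (he _ _ xy0) z0 => /=; case: (v x0); case: (v y0); case: z {hm he} => //=.
rewrite zE in hm he *; apply/le_R/h => [x /hm/le_R //|x y /he/le_R].
by rewrite /=; case: (v x); case: (v y).
Qed.

End Graph.

(** * The listed identities as clauses, and reducibility to them *)

(** These are the normal clauses of the identities of the same names, except that [c_iota_2] and
    [c_iota_2D] use a path shorter by two edges. *)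
Definition c_tau : clause := ([:: [:: 0]], [:: 1]).
Definition c_chi : clause := ([:: [:: 0; 1]], [:: 0; 0]).
Definition c_s : clause := ([:: [:: 0]; [:: 0; 1]], [:: 0; 0]).
Definition c_xi : clause := ([:: [:: 0]; [:: 1]; [:: 0; 1]], [:: 0; 0]).
Definition c_beta : clause := ([:: [:: 0]; [:: 0; 1]; [:: 2]; [:: 2; 3]], [:: 0; 3]).
Definition c_rho : clause := ([:: [:: 0; 1]], [:: 0]).
Definition c_zeta : clause := ([:: [:: 0]; [:: 0; 1]; [:: 2; 3]], [:: 2]).
Definition c_omega : clause := ([:: [:: 0]; [:: 0; 1]], [:: 1]).
Definition c_eta : clause := ([:: [:: 0]; [:: 0; 1]; [:: 1; 2]], [:: 2]).
Definition c_lambda : clause := ([:: [:: 0]; [:: 1]; [:: 0; 1]; [:: 0; 2]], [:: 2]).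
Definition c_zeta_D : clause := ([:: [:: 0]; [:: 1]; [:: 0; 1]; [:: 2; 3]], [:: 2]).
Definition c_omega_D : clause :=
  ([:: [:: 0]; [:: 0; 1]; [:: 2]; [:: 3]; [:: 2; 3]], [:: 1]).
Definition c_eta_D : clause :=
  ([:: [:: 0]; [:: 0; 1]; [:: 1; 2]; [:: 3]; [:: 4]; [:: 3; 4]], [:: 2]).
Definition c_delta : clause := ([:: [:: 0; 1]; [:: 1; 2]; [:: 2; 3]], [:: 0; 3]).
Definition c_nu : clause :=
  ([:: [:: 0]; [:: 0; 1]; [:: 2; 3]; [:: 3; 4]; [:: 4; 5]], [:: 2; 5]).
Definition c_nu_D : clause :=
  ([:: [:: 0; 1]; [:: 1; 2]; [:: 2; 3]; [:: 4]; [:: 5]; [:: 4; 5]], [:: 0; 3]).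
Definition c_iota_2 : clause :=
  ([:: [:: 0]; [:: 1; 0]; [:: 0; 2]; [:: 2; 3]], [:: 1; 3]).
Definition c_iota_2D : clause :=
  ([:: [:: 0]; [:: 1; 0]; [:: 0; 2]; [:: 2; 3]; [:: 4]; [:: 5]; [:: 4; 5]], [:: 1; 3]).
Definition c_mu_2 : clause :=
  ([:: [:: 0]; [:: 1]; [:: 2; 0]; [:: 0; 1]; [:: 1; 3]], [:: 2; 3]).
Definition c_gamma_1 : clause :=
  ([:: [:: 0]; [:: 1]; [:: 0; 2]; [:: 2; 1]; [:: 1; 3]], [:: 0; 3]).

Definition clauses11 : seq clause :=
  [:: c_tau; c_chi; c_s; c_xi; c_beta; c_rho; c_zeta; c_omega; c_eta; c_lambda;
      c_zeta_D; c_omega_D; c_eta_D; c_delta; c_nu; c_nu_D; c_iota_2; c_iota_2D;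
      c_mu_2].

Definition reducible (W : set algebra) (cs : seq clause) (P : algebra -> Prop) : Prop :=
  exists2 ds : seq clause, {subset ds <= cs} &
    forall A, W A -> P A <-> forall d, d \in ds -> sat A d.

Lemma reducible1 W cs c (P : algebra -> Prop) : c \in cs ->
  (forall A, W A -> P A <-> sat A c) -> reducible W cs P.
Proof.
move=> cc h; exists [:: c] => [d|A /h ->]; first by rewrite inE => /eqP->.
split=> [? d|/(_ c)]; first by rewrite inE => /eqP->.
by apply; rewrite inE.
Qed.

Lemma reducible_true W cs (P : algebra -> Prop) :
  (forall A, W A -> P A) -> reducible W cs P.
Proof. by move=> h; exists [::] => // A /h. Qed.

Lemma reducible_iff W cs (P Q : algebra -> Prop) :
  (forall A, W A -> P A <-> Q A) -> reducible W cs Q -> reducible W cs P.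
Proof.
by move=> PQ [ds dcs h]; exists ds => // A WA; rewrite (PQ _ WA); exact: h.
Qed.

Lemma reducible_and W cs (P Q : algebra -> Prop) :
  reducible W cs P -> reducible W cs Q -> reducible W cs (fun A => P A /\ Q A).
Proof.
move=> [ds dcs dP] [ds' dcs' dQ]; exists (ds ++ ds') => [d|A WA].
  by rewrite mem_cat => /orP[/dcs|/dcs'].
rewrite (dP _ WA) (dQ _ WA); split=> [[h h'] d|h].
  by rewrite mem_cat => /orP[/h|/h'].
by split=> d dd; apply: h; rewrite mem_cat dd ?orbT.
Qed.

Lemma reducible_all W cs (T : eqType) (s : seq T) (P : T -> algebra -> Prop) :
  (forall x, x \in s -> reducible W cs (P x)) ->
  reducible W cs (fun A => forall x, x \in s -> P x A).
Proof.
elim: s => [|x s IH] h; first exact: reducible_true.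
have := reducible_and (h x (mem_head _ _)) (IH (fun y ys => h y (mem_behead (s := x :: s) ys))).
apply: reducible_iff => A _; split=> [hx|[Px hs] y]; first split=> [|y ys].
- by apply: hx; exact: mem_head.
- by apply: hx; rewrite inE ys orbT.
- by rewrite inE => /orP[/eqP->|/hs].
Qed.

Ltac splits := simpl; repeat match goal with |- _ /\ _ => split | |- True => exact I end.

(** * Sides of a component *)

Section Opposite.
Variable t : term.

(* When [t] has a colouring, these say that [x] and [y] lie in one component, on
   opposite sides, resp. on the same side. *)
Definition opp x y : Prop := forall col, colouring t col -> col x != col y.
Definition same x y : Prop := forall col, colouring t col -> col x = col y.
Definition linked x y : bool := `[< opp x y \/ same x y >].

Lemma edge_opp x y : edge t x y -> opp x y.
Proof. by move=> xy col; exact. Qed.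

Lemma oppC x y : opp x y -> opp y x.
Proof. by move=> h col /h; rewrite eq_sym. Qed.

Lemma sameC x y : same x y -> same y x.
Proof. by move=> h col /h. Qed.

Lemma same_refl x : same x x.
Proof. by []. Qed.

Lemma linked_refl x : linked x x.
Proof. by apply/asboolP; right. Qed.

Lemma opp_same x y z : opp x y -> same y z -> opp x z.
Proof. by move=> xy yz col hc; rewrite -(yz _ hc) xy. Qed.

Lemma same_opp x y z : same x y -> opp y z -> opp x z.
Proof. by move=> xy yz col hc; rewrite (xy _ hc) yz. Qed.

Lemma opp_opp x y z : opp x y -> opp y z -> same x z.
Proof.
move=> xy yz col hc; have := xy _ hc; have := yz _ hc.
by case: (col x); case: (col y); case: (col z).
Qed.

Lemma linked_edge x u w : edge t u w -> linked x u = linked x w.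
Proof.
move=> uw; apply: asbool_equiv_eq; have o := edge_opp uw.
split=> -[h|h]; [right|left|right|left].
- exact: opp_opp h o.
- exact: same_opp h o.
- exact: opp_opp h (oppC o).
- exact: same_opp h (oppC o).
Qed.

Lemma flip_linked x col : colouring t col ->
  colouring t (fun u => if linked x u then ~~ col u else col u).
Proof. by move=> hc; apply: flip_colouring => // u w; exact: linked_edge. Qed.

Lemma linked_cases col x y : colouring t col -> linked x y ->
  if col x == col y then same x y else opp x y.
Proof.
by move=> hc /asboolP[] h; have := h _ hc; [move/negbTE->|move->; rewrite eqxx].
Qed.

Definition has_D : Prop := exists x y, [/\ imark t x, imark t y & opp x y].
Definition has_C : Prop := exists x, imark t x.

(** Without D, the vertices on the side of a mark ([S]) and those opposite to a mark ([O]) are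
    disjoint, and every edge exchanges the two sets; recolouring them and keeping [col] elsewhere
    remains proper. *)
Lemma oriented_colouring col : colouring t col -> ~ has_D ->
  exists2 col', colouring t col' & forall x, imark t x -> col' x.
Proof.
move=> hc nD.
pose S u := `[< exists2 b, imark t b & same b u >].
pose O u := `[< exists2 b, imark t b & opp b u >].
have SO u w : edge t u w -> S u -> O w.
  move=> /edge_opp uw /asboolP[b bm bu]; apply/asboolP; exists b => //.
  exact: same_opp bu uw.
have OS u w : edge t u w -> O u -> S w.
  move=> /edge_opp uw /asboolP[b bm bu]; apply/asboolP; exists b => //.
  exact: opp_opp bu uw.
have nSO u : S u -> O u -> False.
  move=> /asboolP[b bm bu] /asboolP[c cm cu]; apply: nD; exists b, c; split=> //.
  exact: same_opp bu (oppC cu).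
exists (fun u => if S u then true else if O u then false else col u); last first.
  move=> x xm; rewrite ifT //; apply/asboolP; exists x => //; exact: same_refl.
move=> u w uw; have wu : edge t w u by rewrite edgeC.
have := hc _ _ uw; have := (SO _ _ uw, SO _ _ wu, OS _ _ uw, OS _ _ wu, nSO u, nSO w).
case: (S u); case: (S w); case: (O u); case: (O w) => //=; intuition.
Qed.

End Opposite.

(** * Foldings common to both reductions *)

(** For the edge condition of [subst_sat], when the folding depends on colours, on the component of
    [z] and on being [z]: both ends of an edge lie in the same component, which leaves finitely many
    cases. *)
Ltac edge_cases col z :=
  let x := fresh "x" in let y := fresh "y" in let xy := fresh "xy" in
  let cx := fresh "cx" in let cy := fresh "cy" in
  let Cx := fresh "Cx" in let Cy := fresh "Cy" in
  move=> x y xy cx /negbTE cy; have := linked_edge z xy;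
  case Cx: (linked _ z x) => /esym Cy;
  case: (x =P z) => [?|_]; case: (y =P z) => [?|_]; subst;
  rewrite ?linked_refl in Cx Cy |- *; try discriminate;
  rewrite ?Cx ?Cy ?cx ?cy //=; try (by rewrite ?cx in cy);
  try congruence; try by case: (col z).

(** The same with two distinguished letters; that they are not adjacent excludes the one edge the
    folded graph lacks. *)
Ltac pair_cases col p q :=
  let x := fresh "x" in let y := fresh "y" in let xy := fresh "xy" in
  let cx := fresh "cx" in let cy := fresh "cy" in
  let Cx := fresh "Cx" in let Cy := fresh "Cy" in
  move=> x y xy cx /negbTE cy; have := linked_edge p xy;
  case Cx: (linked _ p x) => /esym Cy;
  case: (x =P p) => [?|_]; case: (y =P p) => [?|_];
  case: (x =P q) => [?|_]; case: (y =P q) => [?|_]; subst;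
  rewrite ?linked_refl in Cx Cy |- *; try discriminate;
  try match goal with H : is_true (~~ edge _ _ _) |- _ =>
    first [by rewrite xy in H | by rewrite edgeC xy in H] end;
  rewrite ?Cx ?Cy ?cx ?cy //=; try (by rewrite ?cx in cy);
  try congruence; try (by case: (col p));
  try match goal with H : is_true (_ != _) |- _ =>
    by move: H; rewrite ?cx ?cy; case: (col p) end.

Section Generic.
Variable t : term.

Lemma graph_le_C (A : algebra) (v : nat -> A) S b : graph_le t v S -> imark t b ->
  exists2 y, v b <~ S & mul (v b) (v y) <~ S.
Proof.
by move=> [hm he] bm; have /andP[_ /innerP[y /he by_]] := bm; exists y; first exact: hm.
Qed.

Lemma linked_same col b x : colouring t col -> linked t x b -> col x = col b -> same t b x.
Proof. by move=> hc /(linked_cases hc) + e; rewrite e eqxx => /sameC. Qed.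

Lemma linked_opp col b x : colouring t col -> linked t x b -> col x != col b -> opp t b x.
Proof. by move=> hc /(linked_cases hc) + /negbTE e; rewrite e => /oppC. Qed.

(** What remains of an inequality that forces everything up to the top: the graph folds onto a
    single edge with two, one or no marked ends. *)
Definition nil_clause : clause :=
  if `[< has_D t >] then c_xi else if `[< has_C t >] then c_s else c_chi.

(** Letters of equal colour are folded to the same end of the edge, so the word becomes a square. *)
Lemma pair_nil A col x z : nil_semiring A -> colouring t col -> col x = col z ->
  (~ has_D t -> forall b, imark t b -> col b) ->
  graph_sat t A [:: x; z] -> sat A nil_clause.
Proof.
move=> HA hc xz cm.
pose s u := if col u then 0 else 1.
have E (v : nat -> A) : wval v (map s [:: x; z]) = wval v [:: 0; 0].
  by rewrite /= /s xz; case: (col z) => //; exact: sq_const.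
have he u w : edge t u w -> col u -> ~~ col w -> (s u = 0) * (s w = 1).
  by move=> _; rewrite /s => -> /negbTE->.
rewrite /nil_clause; case: asboolP => [_|nD].
  apply: (subst_sat HA (s := s) hc) => // [u _|u w uw cu cw].
    by rewrite /s; case: ifP.
  by rewrite !(he u w).
case: asboolP => [_|nC].
  apply: (subst_sat HA (s := s) hc) => // [u um|u w uw cu cw].
    by rewrite /s cm.
  by rewrite !(he u w).
apply: (subst_sat HA (s := s) hc) => // [u um|u w uw cu cw].
  by case: nC; exists u.
by rewrite !(he u w).
Qed.

(** The unmarked component of the word folds onto a path of three edges between [x] and [z], and all
    others onto one edge, marked at one end if there are marks at all. Conversely [connected_ind]
    extends the product from [x] two edges at a time by the same identity. *)
Lemma nu_oriented W cs col0 x z : (forall A, W A -> nil_semiring A) ->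
  c_nu \in cs -> c_delta \in cs -> colouring t col0 -> ~ has_D t ->
  ~~ edge t x z -> opp t x z -> (forall b, imark t b -> linked t x b = false) ->
  reducible W cs (fun A => graph_sat t A [:: x; z]).
Proof.
move=> HW nucs deltacs hc0 nD npq xz nm.
have xz' : x <> z by move=> xz'; have := xz _ hc0; rewrite xz' eqxx.
have cxz : linked t x z by apply/asboolP; left.
have nx u : imark t u -> (u == x) = false.
  by case: eqP => // -> /nm; rewrite linked_refl.
have nz u : imark t u -> (u == z) = false.
  by case: eqP => // -> /nm; rewrite cxz.
have [col hc cm] := oriented_colouring hc0 nD.
have := xz _ hc => c0.
have [[b bm]|nC] := pselect (has_C t).
  apply: (reducible1 nucs) => A WA; have HA := HW _ WA.
  split=> [|h v S hv].
    apply: (subst_sat HA (s := fun u => if u == x then 2 else if u == z then 5 else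
      if linked t x u then if col u == col x then 4 else 3 else
      if col u then 0 else 1) hc) => //.
    - by move=> u um; rewrite nx // nz // nm // cm.
    - pair_cases col x z.
    - by move=> v /=; rewrite !eqxx; case: eqP => [/esym//|_].
  have [w h1 h2] := graph_le_C hv bm; have [hm he] := hv.
  apply: (connected_ind (Q := fun u => mul (v x) (v u) <~ S) hc0 xz); first exact: he.
  move=> y u u' k yu uu' _.
  (* The list gives the letters 0 to 5 of [c_nu] their values; the default of [nth] only serves
     letters outside the clause. *)
  refine (h (nth (v x) [:: v b; v w; v x; v y; v u; v u']) S _); splits => //; exact: he.
apply: (reducible1 deltacs) => A WA; have HA := HW _ WA.
split=> [|h v S hv].
  apply: (subst_sat HA (s := fun u => if u == x then 0 else if u == z then 3 else
    if col u == col x then 2 else 1) hc) => //.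
  - by move=> u um; case: nC; exists u.
  - pair_cases col x z.
  - by move=> v /=; rewrite !eqxx; case: eqP => [/esym//|_].
have [hm he] := hv.
apply: (connected_ind (Q := fun u => mul (v x) (v u) <~ S) hc0 xz); first exact: he.
move=> y u u' k yu uu' _.
refine (h (nth (v x) [:: v x; v y; v u; v u']) S _); splits => //; exact: he.
Qed.

End Generic.

(** * Reduction of inequalities over V(R_11) *)

Section Reduce11.
Variables (t : term) (x0 y0 : nat) (col0 : nat -> bool).
Hypotheses (short : ~~ long t) (xy0 : edge t x0 y0) (hc0 : colouring t col0).
Notation W := (V (R 1 1)).

(** A marked vertex takes the value [ma] or [mb], the only vertices below [mc] in R_11, and each of
    these has product [mc] with both elements of the other side. *)
Lemma mark_opp11 (A : algebra) b z (v : nat -> A) S : W A -> imark t b ->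
  inner t z -> opp t b z -> graph_le t v S -> mul (v b) (v z) <~ S.
Proof.
move=> WA bm zi bz; have HA := nil_semiring_V WA.
suff h : graph_sat t A [:: b; z] by exact: h.
move=> {v S}.
have /andP[_ bi] := bm.
apply/(graph_satE short xy0 HA) => //=; first by rewrite bi zi.
apply: (valid_sat (w := [:: b; z]) xy0 isT WA) => v vm ve.
have hc : colouring t (fun u => if v u is (ma | mp) then true else false).
  by move=> u w /ve; case: (v u); case: (v w).
have := bz _ hc; have := vm _ bm.
have [y by_] := innerP bi; have [y' zy'] := innerP zi.
have := ve _ _ by_; have := ve _ _ zy' => /=.
by case: (v b); case: (v z); case: (v y); case: (v y').
Qed.

Lemma uncolourable11 A : W A -> forall w, w != [::] ->
  ~ (exists col, colouring t col) -> sat A (words t, w).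
Proof.
move=> WA w w0 nc; apply: (valid_sat xy0 w0 WA) => v _ ve.
case: nc; exists (fun u => if v u is (ma | mp) then true else false).
by move=> u w' /ve; case: (v u); case: (v w').
Qed.

Lemma graph_le_D (A : algebra) (v : nat -> A) S b b' : W A -> graph_le t v S ->
  imark t b -> imark t b' -> opp t b b' ->
  [/\ v b <~ S, v b' <~ S & mul (v b) (v b') <~ S].
Proof.
move=> WA hv bm bm' bb'; have [hm he] := hv; split; [exact: hm|exact: hm|].
by apply: (mark_opp11 WA _ _ _ hv) => //; case/andP: bm'.
Qed.

Lemma collapses11 A : W A -> collapses t A <-> sat A (nil_clause t).
Proof.
move=> WA; have HA := nil_semiring_V WA; rewrite /nil_clause.
case: asboolP => [[b [b' [bm bm' bb']]]|nD].
  split=> [|h v S hv].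
    apply: (subst_collapses HA (s := fun u => if col0 u then 0 else 1) hc0).
      by move=> x _; case: ifP.
    by move=> x y _ -> /negbTE->.
  have [h1 h2 h3] := graph_le_D WA hv bm bm' bb'.
  have := h (nth (v b) [:: v b; v b']) S; simpl => /(_ (conj h1 (conj h2 (conj h3 I)))).
  by move/(le_sq HA).
have [col hc cm] := oriented_colouring hc0 nD.
case: asboolP => [[b bm]|nC].
  split=> [|h v S hv].
    apply: (subst_collapses HA (s := fun u => if col u then 0 else 1) hc).
      by move=> x /cm->.
    by move=> x y _ -> /negbTE->.
  have [y h1 h2] := graph_le_C hv bm.
  have := h (nth (v b) [:: v b; v y]) S; simpl => /(_ (conj h1 (conj h2 I))).
  by move/(le_sq HA).
split=> [|h v S hv].
  apply: (subst_collapses HA (s := fun u => if col u then 0 else 1) hc).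
    by move=> x xm; case: nC; exists x.
  by move=> x y _ -> /negbTE->.
have := h (nth (v x0) [:: v x0; v y0]) S; simpl => /(_ (conj (proj2 hv _ _ xy0) I)).
by move/(le_sq HA).
Qed.

(** The identity is read off from the marks in the component of [z]: on both sides, [c_lambda]; only
    on the side of [z], [c_eta_D] or [c_eta]; only opposite, [c_omega_D] or [c_omega]; none,
    [c_zeta_D], [c_zeta] or [c_rho]. The choice within a group depends on whether D, or at least C,
    occurs in the graph. *)
Lemma unary11 z : inner t z -> ~~ mark t z ->
  reducible W clauses11 (fun A => graph_sat t A [:: z]).
Proof.
move=> zi zm; have [y zy] := innerP zi.
have nz x : imark t x -> (x == z) = false.
  by case: eqP => // -> /andP[]; rewrite (negbTE zm).
pose m1 := exists2 b, imark t b & same t b z.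
pose m2 := exists2 b, imark t b & opp t b z.
have [[b bm bz]|n1] := pselect m1; have [[b' bm' bz']|n2] := pselect m2.
- apply: (@reducible1 _ _ c_lambda) => // A WA; have HA := nil_semiring_V WA.
  split=> [|h v S hv].
    apply: (subst_sat HA (s := fun u => if u == z then 2 else
      if col0 u == col0 z then 1 else 0) hc0) => //.
    + by move=> x /nz->; case: ifP.
    + edge_cases col0 z.
    + by move=> v /=; rewrite eqxx.
  have [h1 h2 h3] := graph_le_D WA hv bm' bm (opp_same bz' (sameC bz)).
  refine (h (nth (v b) [:: v b'; v b; v z]) S _); splits => //.
  exact: (mark_opp11 WA _ _ _ hv).
- have [[d [d' [dm dm' dd']]]|nD] := pselect (has_D t).
    apply: (@reducible1 _ _ c_eta_D) => // A WA; have HA := nil_semiring_V WA.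
    split=> [|h v S hv].
      apply: (subst_sat HA (s := fun u => if u == z then 2 else if linked t z u then
        if col0 u == col0 z then 0 else 1 else if col0 u then 3 else 4) hc0) => //.
      + move=> x xm; rewrite nz //; case: ifP => [zx|_]; last by case: ifP.
        have := linked_cases hc0 zx; rewrite eq_sym; case: ifP => // _ o.
        by case: n2; exists x => //; exact: oppC.
      + edge_cases col0 z.
      + by move=> v /=; rewrite eqxx.
    have [h1 h2 h3] := graph_le_D WA hv dm dm' dd'.
    have [hm he] := hv.
    refine (h (nth (v b) [:: v b; v y; v z; v d; v d']) S _); splits => //.
    + exact: hm.
    + apply: (mark_opp11 WA _ _ _ hv) => //; first exact: edge_innerr zy.
      exact: same_opp bz (edge_opp zy).
    + by apply: he; rewrite edgeC.
  have [col hc cm] := oriented_colouring hc0 nD.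
  apply: (@reducible1 _ _ c_eta) => // A WA; have HA := nil_semiring_V WA.
  split=> [|h v S hv].
    apply: (subst_sat HA (s := fun u => if u == z then 2 else if col u then 0 else 1) hc) => //.
    + by move=> x xm; rewrite nz // cm.
    + have cz := bz _ hc; rewrite cm // in cz; edge_cases col z.
    + by move=> v /=; rewrite eqxx.
  have [hm he] := hv.
  refine (h (nth (v b) [:: v b; v y; v z]) S _); splits => //.
  + exact: hm.
  + apply: (mark_opp11 WA _ _ _ hv) => //; first exact: edge_innerr zy.
    exact: same_opp bz (edge_opp zy).
  + by apply: he; rewrite edgeC.
- have [[d [d' [dm dm' dd']]]|nD] := pselect (has_D t).
    apply: (@reducible1 _ _ c_omega_D) => // A WA; have HA := nil_semiring_V WA.
    split=> [|h v S hv].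
      apply: (subst_sat HA (s := fun u => if linked t z u then
        if col0 u == col0 z then 1 else 0 else if col0 u then 2 else 3) hc0) => //.
      + move=> x xm; case: ifP => [zx|_]; last by case: ifP.
        have := linked_cases hc0 zx; rewrite eq_sym; case: ifP => // _ o.
        by case: n1; exists x => //; exact: sameC.
      + edge_cases col0 z.
      + by move=> v /=; rewrite linked_refl eqxx.
    have [h1 h2 h3] := graph_le_D WA hv dm dm' dd'.
    have [hm he] := hv.
    refine (h (nth (v b') [:: v b'; v z; v d; v d']) S _); splits => //.
    + exact: hm.
    + exact: (mark_opp11 WA _ _ _ hv).
  have [col hc cm] := oriented_colouring hc0 nD.
  apply: (@reducible1 _ _ c_omega) => // A WA; have HA := nil_semiring_V WA.
  split=> [|h v S hv].
    apply: (subst_sat HA (s := fun u => if col u then 0 else 1) hc) => //.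
    + by move=> x xm; rewrite cm.
    + edge_cases col z.
    + by move=> v /=; have := bz' _ hc; rewrite cm //; case: (col z).
  have [hm he] := hv.
  refine (h (nth (v b') [:: v b'; v z]) S _); splits => //.
  + exact: hm.
  + exact: (mark_opp11 WA _ _ _ hv).
- have nc x : imark t x -> linked t z x = false.
    move=> xm; apply/negP => /(linked_cases hc0); case: ifP => _ o.
      by case: n1; exists x => //; exact: sameC.
    by case: n2; exists x => //; exact: oppC.
  have [[d [d' [dm dm' dd']]]|nD] := pselect (has_D t).
    apply: (@reducible1 _ _ c_zeta_D) => // A WA; have HA := nil_semiring_V WA.
    split=> [|h v S hv].
      apply: (subst_sat HA (s := fun u => if linked t z u then
        if col0 u == col0 z then 2 else 3 else if col0 u then 0 else 1) hc0) => //.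
      + by move=> x xm; rewrite nc //; case: ifP.
      + edge_cases col0 z.
      + by move=> v /=; rewrite linked_refl eqxx.
    have [h1 h2 h3] := graph_le_D WA hv dm dm' dd'.
    refine (h (nth (v d) [:: v d; v d'; v z; v y]) S _); splits => //.
    exact: (proj2 hv).
  have [col hc cm] := oriented_colouring hc0 nD.
  have [[b bm]|nC] := pselect (has_C t).
    apply: (@reducible1 _ _ c_zeta) => // A WA; have HA := nil_semiring_V WA.
    split=> [|h v S hv].
      apply: (subst_sat HA (s := fun u => if linked t z u then
        if col u == col z then 2 else 3 else if col u then 0 else 1) hc) => //.
      + by move=> x xm; rewrite nc // cm.
      + edge_cases col z.
      + by move=> v /=; rewrite linked_refl eqxx.
    have [u h1 h2] := graph_le_C hv bm.
    refine (h (nth (v b) [:: v b; v u; v z; v y]) S _); splits => //.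
    exact: (proj2 hv).
  apply: (@reducible1 _ _ c_rho) => // A WA; have HA := nil_semiring_V WA.
  split=> [|h v S hv].
    apply: (subst_sat HA (s := fun u => if col0 u == col0 z then 0 else 1) hc0) => //.
    + by move=> x xm; case: nC; exists x.
    + edge_cases col0 z.
    + by move=> v /=; rewrite eqxx.
  refine (h (nth (v z) [:: v z; v y]) S _); splits => //.
  exact: (proj2 hv).
Qed.

(** * Words of length two over V(R_11) *)

Lemma graph_sat_swap A x z : nil_semiring A ->
  graph_sat t A [:: x; z] <-> graph_sat t A [:: z; x].
Proof. by move=> HA; split=> h v S /h /=; exact: le_mulC. Qed.

Lemma pair_nil11 A col x z : W A -> colouring t col -> col x = col z ->
  (~ has_D t -> forall b, imark t b -> col b) ->
  graph_sat t A [:: x; z] <-> sat A (nil_clause t).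
Proof.
move=> WA hc xz cm; split; first exact: pair_nil (nil_semiring_V WA) hc xz cm.
by move/(collapses11 WA) => h v S /h.
Qed.

(** A component without marks could be flipped without losing the orientation, giving [x] and [z]
    equal colours; so they lie in different components, each carrying a mark. *)
Lemma oriented_pair x z col : ~ has_D t -> colouring t col ->
  (forall b, imark t b -> col b) -> col x != col z ->
  (forall col', colouring t col' -> (forall b, imark t b -> col' b) -> col' x != col' z) ->
  ~ opp t x z ->
  [/\ forall u, linked t x u -> linked t z u -> False,
      exists2 b, imark t b & linked t x b & exists2 b, imark t b & linked t z b].
Proof.
move=> nD hc cm xz hxz no.
have dis u : linked t x u -> linked t z u -> False.
  have [cu|cu] := eqVneq (col u) (col z).
    move=> xu /linked_same/(_ (esym cu)) => /(_ hc) uz; apply: no.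
    by apply: (@opp_same _ _ u) => //; apply/oppC/(linked_opp hc xu); rewrite cu.
  move=> xu /(linked_opp hc); rewrite eq_sym => /(_ cu) uz; apply: no.
  apply: (@same_opp _ _ u) => //; apply/sameC/(linked_same hc xu).
  by move: cu xz; case: (col u); case: (col z); case: (col x).
have flip y y' : linked t y y' = false -> col y != col y' ->
    (forall b, imark t b -> linked t y b = false) ->
    exists2 col', colouring t col' /\ (forall b, imark t b -> col' b) & col' y = col' y'.
  move=> yy' cyy' nm; exists (fun u => if linked t y u then ~~ col u else col u).
    by split; [exact: flip_linked|move=> b bm; rewrite nm // cm].
  by rewrite linked_refl yy'; move: cyy'; case: (col y); case: (col y').
have mx y y' : linked t y y' = false -> col y != col y' ->
    (forall col', colouring t col' -> (forall b, imark t b -> col' b) -> col' y != col' y') ->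
    exists2 b, imark t b & linked t y b.
  move=> yy' cyy' h; apply: contrapT => nm.
  have [] := flip y y' yy' cyy'.
    by move=> b bm; apply/negP => yb; apply: nm; exists b.
  by move=> col' [hc' cm'] /eqP; rewrite (negbTE (h _ hc' cm')).
split=> //.
  by apply: (mx x z) => //; apply/negP => xz'; exact: dis xz' (linked_refl _ _).
apply: (mx z x); rewrite 1?eq_sym //.
  by apply/negP => zx; exact: dis (linked_refl _ _) zx.
by move=> col' hc' cm'; rewrite eq_sym hxz.
Qed.

(** Here [x] lies on the marked side of its component and [z] on the unmarked side of another. If
    [x] itself is unmarked, [c_beta] bounds only the product of [z] with a marked [b] beside [x];
    the passage from [b] to [x] is [c_iota_2], which is also recovered by folding the two components
    together. *)
Lemma beta11 x z col : inner t x -> inner t z -> ~~ edge t x z -> ~ has_D t ->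
  colouring t col -> (forall b, imark t b -> col b) -> col x -> ~~ col z ->
  (forall col', colouring t col' -> (forall b, imark t b -> col' b) -> col' x != col' z) ->
  ~ opp t x z -> reducible W clauses11 (fun A => graph_sat t A [:: x; z]).
Proof.
move=> xi zi npq nD hc cm cx /negbTE cz hxz no.
have [y xy] := innerP xi.
have cxz : col x != col z by rewrite cx cz.
have [dis [b bm bx] [b' bm' bz]] := oriented_pair nD hc cm cxz hxz no.
have {}bx : same t b x by apply: (linked_same hc bx); rewrite cx cm.
have {}bz : opp t b' z by apply: (linked_opp hc bz); rewrite cz cm.
have xz : linked t x z = false by apply/negP => /dis; apply; exact: linked_refl.
have xz' : x <> z by move=> xz'; rewrite xz' linked_refl in xz.
have sub A : W A -> graph_sat t A [:: x; z] -> sat A c_beta.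
  move=> WA; have HA := nil_semiring_V WA.
  apply: (subst_sat HA (s := fun u => if linked t x u then
    if col u then 0 else 1 else if col u then 2 else 3) hc) => //.
  - by move=> u um; rewrite cm //; case: ifP.
  - pair_cases col x z.
  - by move=> v; rewrite /= linked_refl xz cx cz.
have [xm|xm] := boolP (mark t x).
  apply: (@reducible1 _ _ c_beta) => // A WA; have HA := nil_semiring_V WA.
  split=> [|h v S hv]; first exact: sub.
  have [hm he] := hv.
  refine (h (nth (v b) [:: v x; v y; v b'; v z]) S _); splits.
  - by apply: hm; rewrite /imark xm.
  - exact: he.
  - exact: hm.
  - exact: (mark_opp11 WA _ _ _ hv).
exists [:: c_beta; c_iota_2] => [d|A WA].
  by rewrite !inE => /orP[]/eqP->.
have HA := nil_semiring_V WA; split=> [h d|h v S hv].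
  rewrite !inE => /orP[]/eqP->; first exact: sub.
  apply: (subst_sat HA (s := fun u => if u == x then 3 else if u == z then 1 else
    if col u then 0 else 2) hc _ _ _ _ h) => //.
  - move=> u um; rewrite cm //; case: eqP => [ux|_].
      by move: um; rewrite ux /imark (negbTE xm).
    by case: eqP => [uz|_] //; rewrite -uz cm in cz.
  - pair_cases col x z.
  - by move=> v /=; rewrite !eqxx; case: eqP => [/esym//|_]; exact: mulC.
have [hm he] := hv.
have by_ : mul (v b) (v y) <~ S.
  apply: (mark_opp11 WA _ _ _ hv) => //; first exact: edge_innerr xy.
  exact: same_opp bx (edge_opp xy).
have bz' : mul (v b) (v z) <~ S.
  refine (h c_beta _ (nth (v b) [:: v b; v y; v b'; v z]) S _); splits => //.
  - exact: hm.
  - exact: hm.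
  - exact: (mark_opp11 WA _ _ _ hv).
apply: le_mulC => //.
refine (h c_iota_2 _ (nth (v b) [:: v b; v z; v y; v x]) S _); splits => //.
- exact: hm.
- exact: le_mulC.
- by apply: he; rewrite edgeC.
Qed.

(** A mark [b] on the side of [x] may be multiplied with every opposite letter, so [z], [b], [y],
    [x] always acts as a path of three edges, with [b] marked, whatever the distance from [x] to
    [z]. *)
Lemma iota11 x z b : inner t x -> inner t z -> ~~ edge t x z -> opp t x z ->
  ~~ mark t x -> ~~ mark t z -> imark t b -> same t b x ->
  ~ (exists2 b, imark t b & opp t b x) ->
  reducible W clauses11 (fun A => graph_sat t A [:: x; z]).
Proof.
move=> xi zi npq xz xm zm bm bx nm.
have [y xy] := innerP xi.
have xz' : x <> z by move=> xz'; have := xz _ hc0; rewrite xz' eqxx.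
have nx u : imark t u -> (u == x) = false.
  by case: eqP => // -> /andP[]; rewrite (negbTE xm).
have nz u : imark t u -> (u == z) = false.
  by case: eqP => // -> /andP[]; rewrite (negbTE zm).
have cxz : linked t x z by apply/asboolP; left.
have by_ (A : algebra) (v : nat -> A) S : W A -> graph_le t v S ->
    [/\ v b <~ S, mul (v z) (v b) <~ S, mul (v b) (v y) <~ S & mul (v y) (v x) <~ S].
  move=> WA hv; have HA := nil_semiring_V WA; have [hm he] := hv; split.
  - exact: hm.
  - by apply: le_mulC => //; apply: (mark_opp11 WA _ _ _ hv) => //; exact: same_opp bx xz.
  - apply: (mark_opp11 WA _ _ _ hv) => //; first exact: edge_innerr xy.
    exact: same_opp bx (edge_opp xy).
  - by apply: he; rewrite edgeC.
have [[d [d' [dm dm' dd']]]|nD] := pselect (has_D t).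
  apply: (@reducible1 _ _ c_iota_2D) => // A WA; have HA := nil_semiring_V WA.
  split=> [|h v S hv].
    have := xz _ hc0 => c0.
    apply: (subst_sat HA (s := fun u => if u == x then 3 else if u == z then 1 else
      if linked t x u then if col0 u == col0 x then 0 else 2 else
      if col0 u then 4 else 5) hc0) => //.
    - move=> u um; rewrite nx // nz //; case: ifP => xu; last by case: ifP.
      have := linked_cases hc0 xu; rewrite eq_sym; case: ifP => // _ o.
      by case: nm; exists u => //; exact: oppC.
    - pair_cases col0 x z.
    - by move=> v /=; rewrite !eqxx; case: eqP => [/esym//|_]; exact: mulC.
  have [h1 h2 h3] := graph_le_D WA hv dm dm' dd'.
  have [k1 k2 k3 k4] := by_ _ _ _ WA hv.
  apply: le_mulC => //.
  by refine (h (nth (v b) [:: v b; v z; v y; v x; v d; v d']) S _); splits.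
have [col hc cm] := oriented_colouring hc0 nD.
apply: (@reducible1 _ _ c_iota_2) => // A WA; have HA := nil_semiring_V WA.
split=> [|h v S hv].
  have cx : col x by rewrite -(bx _ hc) cm.
  have /esym cz : false = col z by have := xz _ hc; rewrite cx; case: (col z).
  apply: (subst_sat HA (s := fun u => if u == x then 3 else if u == z then 1 else
    if col u then 0 else 2) hc) => //.
  - by move=> u um; rewrite nx // nz // cm.
  - pair_cases col x z.
  - by move=> v /=; rewrite !eqxx; case: eqP => [/esym//|_]; exact: mulC.
have [k1 k2 k3 k4] := by_ _ _ _ WA hv.
apply: le_mulC => //.
by refine (h (nth (v b) [:: v b; v z; v y; v x]) S _); splits.
Qed.

Lemma nu11 x z : inner t x -> inner t z -> ~~ edge t x z -> opp t x z ->
  (forall b, imark t b -> linked t x b = false) ->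
  reducible W clauses11 (fun A => graph_sat t A [:: x; z]).
Proof.
move=> xi zi npq xz nm.
have xz' : x <> z by move=> xz'; have := xz _ hc0; rewrite xz' eqxx.
have cxz : linked t x z by apply/asboolP; left.
have nx u : imark t u -> (u == x) = false.
  by case: eqP => // -> /nm; rewrite linked_refl.
have nz u : imark t u -> (u == z) = false.
  by case: eqP => // -> /nm; rewrite cxz.
have [[d [d' [dm dm' dd']]]|nD] := pselect (has_D t).
  apply: (@reducible1 _ _ c_nu_D) => // A WA; have HA := nil_semiring_V WA.
  split=> [|h v S hv].
    have := xz _ hc0 => c0.
    apply: (subst_sat HA (s := fun u => if u == x then 0 else if u == z then 3 else
      if linked t x u then if col0 u == col0 x then 2 else 1 else
      if col0 u then 4 else 5) hc0) => //.
    - by move=> u um; rewrite nx // nz // nm //; case: ifP.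
    - pair_cases col0 x z.
    - by move=> v /=; rewrite !eqxx; case: eqP => [/esym//|_].
  have [h1 h2 h3] := graph_le_D WA hv dm dm' dd'; have [hm he] := hv.
  apply: (connected_ind (Q := fun u => mul (v x) (v u) <~ S) hc0 xz); first exact: he.
  move=> y u u' k yu uu' _.
  refine (h (nth (v x) [:: v x; v y; v u; v u'; v d; v d']) S _); splits => //; exact: he.
by apply: (nu_oriented _ _ _ hc0 nD) => // A; exact: nil_semiring_V.
Qed.

(** If the letters are not opposite, the word folds to a square, except when orientation of marked
    components keeps them apart ([beta11]). If they are opposite and unmarked, marks on both sides
    of their component give [c_mu_2], on one side [iota11], on none [nu11]. *)
Lemma pair11 x z : inner t x -> inner t z ->
  reducible W clauses11 (fun A => graph_sat t A [:: x; z]).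
Proof.
move=> xi zi.
have nilW (P : algebra -> Prop) : (forall A, W A -> P A <-> sat A (nil_clause t)) ->
    reducible W clauses11 P.
  by apply: reducible1; rewrite /nil_clause; case: ifP => _ //; case: ifP.
have [exz|nxz] := boolP (edge t x z).
  by apply: reducible_true => A _ v S [_ he]; exact: he.
have [xz|nopp] := pselect (opp t x z); last first.
  have [nD|D] := pselect (~ has_D t); last first.
    have [col hc e] : exists2 col, colouring t col & col x = col z.
      apply: contrapT => h; apply: nopp => col hc; apply/eqP => e; apply: h.
      by exists col.
    by apply: nilW => A WA; exact: pair_nil11 WA hc e _.
  have [[col [hc cm e]]|h] := pselect (exists col, [/\ colouring t col,
      forall b, imark t b -> col b & col x = col z]).
    by apply: nilW => A WA; exact: pair_nil11 WA hc e _.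
  have hxz col : colouring t col -> (forall b, imark t b -> col b) -> col x != col z.
    by move=> hc cm; apply/eqP => e; apply: h; exists col.
  have [col hc cm] := oriented_colouring hc0 nD; have := hxz _ hc cm.
  case cx: (col x); case cz: (col z) => // _.
    by apply: (beta11 xi zi nxz nD hc cm cx _ hxz nopp); rewrite cz.
  apply: (reducible_iff (fun A (WA : W A) => graph_sat_swap x z (nil_semiring_V WA))).
  apply: (beta11 zi xi _ nD hc cm cz _ _ _); rewrite ?cx 1?edgeC //.
    by move=> col' hc' cm'; rewrite eq_sym hxz.
  by move/oppC.
have [xm|xm] := boolP (mark t x).
  apply: reducible_true => A WA v S hv /=.
  by apply: (mark_opp11 WA _ _ _ hv) => //; rewrite /imark xm.
have [zm|zm] := boolP (mark t z).
  apply: reducible_true => A WA v S hv /=; apply: (le_mulC (nil_semiring_V WA)).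
  by apply: (mark_opp11 WA _ _ _ hv) => //; [rewrite /imark zm|exact: oppC].
have [[b bm bx]|n1] := pselect (exists2 b, imark t b & same t b x);
have [[b' bm' bx']|n2] := pselect (exists2 b, imark t b & opp t b x).
- have nx u : imark t u -> (u == x) = false.
    by case: eqP => // -> /andP[]; rewrite (negbTE xm).
  have nz u : imark t u -> (u == z) = false.
    by case: eqP => // -> /andP[]; rewrite (negbTE zm).
  have npq := nxz; have c0 := xz _ hc0.
  apply: (@reducible1 _ _ c_mu_2) => // A WA; have HA := nil_semiring_V WA.
  split=> [|h v S hv].
    apply: (subst_sat HA (s := fun u => if u == x then 2 else if u == z then 3 else
      if col0 u == col0 x then 1 else 0) hc0) => //.
    + by move=> u um; rewrite nx // nz //; case: ifP.
    + pair_cases col0 x z.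
    + move=> v /=; rewrite !eqxx; case: eqP => [zx|_] //.
      by move: c0; rewrite zx eqxx.
  have [h1 h2 h3] := graph_le_D WA hv bm' bm (opp_same bx' (sameC bx)).
  refine (h (nth (v x) [:: v b'; v b; v x; v z]) S _); splits => //.
  + by apply: le_mulC => //; apply: (mark_opp11 WA _ _ _ hv).
  + by apply: (mark_opp11 WA _ _ _ hv) => //; exact: same_opp bx xz.
- exact: iota11 bm bx n2.
- apply: (reducible_iff (fun A (WA : W A) => graph_sat_swap x z (nil_semiring_V WA))).
  apply: (iota11 zi xi _ (oppC xz) zm xm bm'); rewrite 1?edgeC //.
    exact: opp_opp bx' xz.
  by move=> [u um uz]; apply: n1; exists u => //; exact: opp_opp uz (oppC xz).
- apply: nu11 => // b bm; apply/negP => /(linked_cases hc0); case: ifP => _ o.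
    by case: n1; exists b => //; exact: sameC.
  by case: n2; exists b => //; exact: oppC.
Qed.

End Reduce11.

(** * Degenerate words, and the reduction over V(R_11) assembled *)

Lemma reducible_flat W cs t w : (forall A, W A -> nil_semiring A) -> c_tau \in cs ->
  w != [::] -> ~~ long t -> (forall x y, ~~ edge t x y) ->
  reducible W cs (fun A => sat A (words t, w)).
Proof.
move=> HW ctau w0 short flat.
have wt u : u \in words t -> exists x, u = [:: x].
  move=> ut; have := words_nonempty ut; have := hasPn short _ ut.
  case: u ut => [|x [|y [|]]] //= ut _ _; first by exists x.
  by have := flat x y; rewrite /edge ut.
have [[x ->]|nx] := pselect (exists x, w = [:: x]); last first.
  apply: (reducible1 ctau) => A /HW HA; split=> [h v S [h0 _]|h v S _].
    (* With all letters equal to [v 0], the premises hold with bound [v 0], while the word is a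
       power of [v 0], that is, the top. *)
    have /= := h (fun=> v 0) (v 0); have b0 : below (fun=> v 0) (v 0) (words t).
      by apply/belowP => u /wt[x ->] /=; exact: le_refl.
    move/(_ b0); case: w w0 nx {h} => [|x [|y w]] // _ nx.
      by case: nx; exists x.
    case: w {nx} => [|z w] /= h; apply: (le_trans HA _ h0); last exact: (le_cube HA h).
    by move: h; exact: le_sq.
  by have := h (fun n => if n == 0 then S else wval v w) S; apply; splits; exact: le_refl.
have [xt|xt] := boolP ([:: x] \in words t).
  by apply: reducible_true => A _ v S /belowP; apply.
apply: (reducible1 ctau) => A /HW HA; split=> [h v S [h0 _]|h v S _] /=.
  have := h (fun n => if n == x then v 1 else v 0) S; rewrite /= eqxx; apply.
  apply/belowP => u ut; have [y yE] := wt _ ut; rewrite yE /=.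
  by case: eqP => // yx; rewrite -yx -yE ut in xt.
by have := h (fun n => if n == 0 then S else v x) S; apply; splits; exact: le_refl.
Qed.

Lemma word_cases t w : w != [::] ->
  [\/ [\/ 2 < size w, exists x, w = [:: x; x],
          exists2 x, w = [:: x] & ~~ inner t x && ~~ mark t x |
          exists x y, w = [:: x; y] /\ ~~ (inner t x && inner t y)],
      w \in words t,
      exists x, [/\ w = [:: x], inner t x & ~~ mark t x] |
      exists x y, [/\ w = [:: x; y], inner t x & inner t y]].
Proof.
case: w => [|x [|y [|z w]]] // _; last by do 2 constructor.
- have [xm|xm] := boolP (mark t x); first by constructor 2.
  have [xi|xi] := boolP (inner t x); first by constructor 3; exists x.
  by constructor 1; constructor 3; exists x => //; rewrite xi xm.
- have [/andP[xi yi]|xyi] := boolP (inner t x && inner t y).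
    by constructor 4; exists x, y.
  by constructor 1; constructor 4; exists x, y.
Qed.

Lemma reducible_words i j cs t w : c_tau \in cs -> w != [::] ->
  (forall x y, ~~ long t -> edge t x y ->
     reducible (V (R i j)) cs (fun A => sat A (words t, w))) ->
  reducible (V (R i j)) cs (fun A => sat A (words t, w)).
Proof.
move=> ctau w0 h; have [lt|short] := boolP (long t).
  apply: reducible_true => A /nil_semiring_V HA v S /belowP b.
  by have /hasP[u ut u2] := lt; have := b _ ut; exact: wval_long.
have [[x [y xy]]|flat] := pselect (exists x y, edge t x y); first exact: h xy.
apply: reducible_flat => // [A /nil_semiring_V //|x y].
by apply/negP => xy; apply: flat; exists x, y.
Qed.

Lemma reduce11 t w : w != [::] ->
  reducible (V (R 1 1)) clauses11 (fun A => sat A (words t, w)).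
Proof.
move=> w0; apply: reducible_words => // x0 y0 short xy0.
have [[col0 hc0]|nc] := pselect (exists col, colouring t col); last first.
  by apply: reducible_true => A WA; exact: (uncolourable11 xy0 WA w0 nc).
have [wc|wt|[x [wE xi xm]]|[x [y [wE xi yi]]]] := word_cases t w0.
- apply: (reducible1 (c := nil_clause t)).
    by rewrite /nil_clause; case: ifP => _ //; case: ifP.
  move=> A WA; rewrite (collapsesE short xy0 (nil_semiring_V WA) wc).
  exact: (collapses11 short xy0 hc0).
- by apply: reducible_true => A _ v S /belowP; apply.
- apply: (reducible_iff _ (unary11 short xy0 hc0 xi xm)) => A WA.
  by rewrite wE; apply: (graph_satE short xy0 (nil_semiring_V WA)); rewrite //= xi.
- apply: (reducible_iff _ (pair11 short xy0 hc0 xi yi)) => A WA.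
  by rewrite wE; apply: (graph_satE short xy0 (nil_semiring_V WA)); rewrite //= xi yi.
Qed.

(** * Reduction of inequalities over V(R_02) *)

Definition clauses02 : seq clause :=
  [:: c_tau; c_chi; c_s; c_beta; c_delta; c_nu; c_gamma_1].

Section Reduce02.
Variables (t : term) (x0 y0 : nat) (col0 : nat -> bool).
Notation W := (V (R 0 2)).

(** In R_02 the vertices below [mc] are [mb] and [mq], so an assignment not sending the term to [m0]
    puts all marked letters on the side {b, q}, here coloured [true]. *)
Definition oriented (col : nat -> bool) : Prop :=
  colouring t col /\ forall b, imark t b -> col b.

Hypotheses (short : ~~ long t) (xy0 : edge t x0 y0).

Lemma uncolourable02 A : W A -> forall w, w != [::] ->
  ~ (exists col, oriented col) -> sat A (words t, w).
Proof.
move=> WA w w0 nc; apply: (valid_sat xy0 w0 WA) => v vm ve.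
case: nc; exists (fun u => if v u is (mb | mq) then true else false).
split=> [u w' /ve|b bm]; first by case: (v u); case: (v w').
have /andP[_ /innerP[y /ve]] := bm.
by have := vm _ bm; case: (v b); case: (v y).
Qed.

Hypothesis hc0 : oriented col0.

(** Such a letter always takes the value [mb] or [mq], both below [mc]: being forced onto the marked
    side is as good as a mark. *)
Lemma mark02 (A : algebra) x (v : nat -> A) S : W A -> inner t x ->
  (forall col, oriented col -> col x) -> graph_le t v S -> v x <~ S.
Proof.
move=> WA xi hx; have HA := nil_semiring_V WA.
suff h : graph_sat t A [:: x] by exact: h.
move=> {v S}; apply/(graph_satE short xy0 HA) => //=; first by rewrite xi.
apply: (valid_sat (w := [:: x]) xy0 isT WA) => v vm ve /=.
have := hx (fun u => if v u is (mb | mq) then true else false).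
case: (v x) => // h; have // : false; apply: h; split=> [u w /ve|b bm].
all: try by case: (v u); case: (v w).
all: have /andP[_ /innerP[y /ve]] := bm.
all: by have := vm _ bm; case: (v b); case: (v y).
Qed.

Lemma no_D02 : ~ has_D t.
Proof. by case: hc0 => hc cm [b [b' [/cm cb /cm cb' /(_ _ hc)]]]; rewrite cb cb'. Qed.

Lemma both_marked02 A : W A -> sat A c_xi.
Proof.
move=> WA; apply/(holds_sq (nil_semiring_V WA) 0 id_xi.2); move/in_V: WA; apply=> v /=.
by case: (v 0); case: (v 1).
Qed.

Lemma collapses02 A : W A -> collapses t A <-> sat A (nil_clause t).
Proof.
move=> WA; have HA := nil_semiring_V WA; have [hc cm] := hc0.
rewrite /nil_clause asboolF; last exact: no_D02.
case: asboolP => [[b bm]|nC].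
  split=> [|h v S hv].
    apply: (subst_collapses HA (s := fun u => if col0 u then 0 else 1) hc).
      by move=> x /cm->.
    by move=> x y _ -> /negbTE->.
  have [y h1 h2] := graph_le_C hv bm.
  have := h (nth (v b) [:: v b; v y]) S; simpl => /(_ (conj h1 (conj h2 I))).
  by move/(le_sq HA).
split=> [|h v S hv].
  apply: (subst_collapses HA (s := fun u => if col0 u then 0 else 1) hc).
    by move=> x xm; case: nC; exists x.
  by move=> x y _ -> /negbTE->.
have := h (nth (v x0) [:: v x0; v y0]) S; simpl => /(_ (conj (proj2 hv _ _ xy0) I)).
by move/(le_sq HA).
Qed.

(** If [z] can avoid the marked side, folding bounds the unmarked end of an edge; since [c_xi] holds
    throughout this variety, both ends being bounded already means collapse. *)
Lemma unary02 z : inner t z -> reducible W clauses02 (fun A => graph_sat t A [:: z]).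
Proof.
move=> zi; have [hz|nz] := pselect (forall col, oriented col -> col z).
  by apply: reducible_true => A WA v S; exact: mark02.
have [col [hc cm] cz] : exists2 col, oriented col & ~~ col z.
  apply: contrapT => h; apply: nz => col hc; apply: contrapT => /negP cz.
  by apply: h; exists col.
apply: (@reducible1 _ _ (nil_clause t)).
  by rewrite /nil_clause asboolF; [case: ifP|exact: no_D02].
move=> A WA; split; last by move/(collapses02 WA) => h v S /h.
have HA := nil_semiring_V WA; have xi := both_marked02 WA.
pose s u := if col u then 0 else 1.
have he u w : edge t u w -> col u -> ~~ col w -> (s u = 0) * (s w = 1).
  by move=> _; rewrite /s => -> /negbTE->.
have sz (v : nat -> A) : wval v (map s [:: z]) = v 1 by rewrite /= /s (negbTE cz).
rewrite /nil_clause asboolF; last exact: no_D02.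
case: asboolP => [_|nC] h.
  have : sat A c_omega.
    apply: (subst_sat (c := c_omega) HA (s := s) hc _ _ _ sz h) => // [u um|u w uw cu cw].
      by rewrite /s cm.
    by rewrite !(he u w).
  move=> omega v S /= [k0 [k01 _]]; apply: (xi v S) => /=; splits => //.
  by apply: (omega v S); splits.
have rho : sat A ([:: [:: 0; 1]], [:: 1]).
  apply: (subst_sat (c := ([:: [:: 0; 1]], [:: 1])) HA (s := s) hc _ _ _ sz h) => //
    [u um|u w uw cu cw].
    by case: nC; exists u.
  by rewrite !(he u w).
move=> v S /= [k01 _]; apply: (xi v S) => /=; splits => //; last by apply: (rho v S); splits.
by refine (rho (nth (v 0) [:: v 1; v 0]) S _); splits; exact: le_mulC.
Qed.

(** Within one component the folded graph is a path with its start and third vertex marked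
    ([c_gamma_1]); across two components it is a pair of half-marked edges ([c_beta]). *)
Lemma fixed02 x z : inner t x -> inner t z -> ~~ edge t x z ->
  (forall col, oriented col -> col x) -> (forall col, oriented col -> ~~ col z) ->
  reducible W clauses02 (fun A => graph_sat t A [:: x; z]).
Proof.
move=> xi zi nxz hx hz; have [hc cm] := hc0.
have [y xy] := innerP xi; have [y' zy'] := innerP zi.
have cx : col0 x = true := hx _ hc0; have cz : col0 z = false := negbTE (hz _ hc0).
have xz' : x <> z by move=> e; rewrite -e cx in cz.
have c0 : col0 x != col0 z by rewrite cx cz.
have [xz|xz] := boolP (linked t x z).
  have oxz : opp t x z.
    by have := linked_cases hc xz; rewrite (negbTE c0).
  apply: (@reducible1 _ _ c_gamma_1) => // A WA; have HA := nil_semiring_V WA.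
  split=> [|h v S hv].
    apply: (subst_sat HA (s := fun u => if u == x then 0 else if u == z then 3 else
      if col0 u then 1 else 2) hc) => //.
    - move=> u um; rewrite cm //; case: ifP => // _; case: eqP => // uz.
      by rewrite -uz cm in cz.
    - pair_cases col0 x z.
    - by move=> v /=; rewrite !eqxx; case: eqP => [/esym//|_].
  have [hm he] := hv.
  suff [] : linked t x z /\ mul (v x) (v z) <~ S by [].
  (* The invariant also records the component, so that [mark02] applies to the intermediate vertices
     on the side of [x]. *)
  apply: (connected_ind (Q := fun u => linked t x u /\ mul (v x) (v u) <~ S) hc oxz).
    move=> u xu; split; last exact: he.
    by rewrite -(linked_edge x xu) linked_refl.
  move=> w u u' [xw xwS] wu uu' cu.
  have xu : linked t x u by rewrite -(linked_edge x wu).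
  have sxu := linked_cases hc xu; rewrite cu eqxx in sxu.
  split; first by rewrite -(linked_edge x uu').
  refine (h (nth (v x) [:: v x; v u; v w; v u']) S _); splits => //.
  - exact: mark02 hv.
  - apply: (mark02 WA _ _ hv) => [|col [hcol ?]]; first exact: edge_inner uu'.
    by rewrite -(sxu _ hcol); apply: hx.
  - exact: he.
  - exact: he.
apply: (@reducible1 _ _ c_beta) => // A WA; have HA := nil_semiring_V WA.
split=> [|h v S hv].
  apply: (subst_sat HA (s := fun u => if linked t x u then
    if col0 u then 0 else 1 else if col0 u then 2 else 3) hc) => //.
  - by move=> u um; rewrite cm //; case: ifP.
  - pair_cases col0 x z.
  - by move=> v; rewrite /= linked_refl (negbTE xz) cx cz.
have [hm he] := hv.
refine (h (nth (v x) [:: v x; v y; v y'; v z]) S _); splits.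
- exact: mark02 hv.
- exact: he.
- apply: (mark02 WA _ _ hv) => [|col hcol]; first exact: edge_innerr zy'.
  by have := proj1 hcol _ _ zy'; have := hz _ hcol; case: (col z); case: (col y').
- by apply: he; rewrite edgeC.
Qed.

(** If neither letter is forced onto a side, the component of [x] has no marks; being flippable, it
    must also contain [z], and [nu_oriented] applies. *)
Lemma pair02 x z : inner t x -> inner t z ->
  reducible W clauses02 (fun A => graph_sat t A [:: x; z]).
Proof.
move=> xi zi; have [hc cm] := hc0.
have [exz|nxz] := boolP (edge t x z).
  by apply: reducible_true => A _ v S [_ he]; exact: he.
have [[col [hc' cm'] e]|h] := pselect (exists2 col, oriented col & col x = col z).
  apply: (@reducible1 _ _ (nil_clause t)).
    by rewrite /nil_clause asboolF; [case: ifP|exact: no_D02].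
  move=> A WA; split; last by move/(collapses02 WA) => h v S /h.
  exact: pair_nil (nil_semiring_V WA) hc' e (fun=> cm').
have hxz col : oriented col -> col x != col z.
  by move=> hcol; apply/eqP => e; apply: h; exists col.
have [hx|nx] := pselect (forall col, oriented col -> col x).
  by apply: fixed02 => // col hcol; have := hxz _ hcol; rewrite hx //; case: (col z).
have [hx|nx'] := pselect (forall col, oriented col -> ~~ col x).
  apply: (reducible_iff (fun A (WA : W A) => graph_sat_swap t x z (nil_semiring_V WA))).
  apply: fixed02 => //; first by rewrite edgeC.
  by move=> col hcol; have := hxz _ hcol; rewrite (negbTE (hx _ hcol)); case: (col z).
have free b : imark t b -> linked t x b = false.
  move=> bm; apply/negP => /asboolP[xb|xb].
    apply: nx' => col [hcol hm]; have := xb _ hcol; rewrite (hm _ bm).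
    by case: (col x).
  by apply: nx => col [hcol hm]; rewrite (xb _ hcol) (hm _ bm).
have xz : opp t x z.
  have cxz := hxz _ hc0; have [xz|xz] := boolP (linked t x z).
    by have := linked_cases hc xz; rewrite (negbTE cxz).
  have := hxz (fun u => if linked t x u then ~~ col0 u else col0 u).
  rewrite linked_refl (negbTE xz) => flip; suff : ~~ col0 x != col0 z.
    by case: (col0 x) cxz; case: (col0 z).
  by apply: flip; split; [exact: flip_linked|move=> b bm; rewrite free // cm].
apply: (nu_oriented _ _ _ hc no_D02) => // A; exact: nil_semiring_V.
Qed.

End Reduce02.

Lemma reduce02 t w : w != [::] ->
  reducible (V (R 0 2)) clauses02 (fun A => sat A (words t, w)).
Proof.
move=> w0; apply: reducible_words => // x0 y0 short xy0.
have [[col0 hc0]|nc] := pselect (exists col, oriented t col); last first.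
  by apply: reducible_true => A WA; exact: (uncolourable02 xy0 WA w0 nc).
have [wc|wt|[x [wE xi xm]]|[x [y [wE xi yi]]]] := word_cases t w0.
- apply: (reducible1 (c := nil_clause t)).
    by rewrite /nil_clause asboolF; [case: ifP|exact: no_D02 hc0].
  move=> A WA; rewrite (collapsesE short xy0 (nil_semiring_V WA) wc).
  exact: (collapses02 xy0 hc0).
- by apply: reducible_true => A _ v S /belowP; apply.
- apply: (reducible_iff _ (unary02 short xy0 hc0 xi)) => A WA.
  by rewrite wE; apply: (graph_satE short xy0 (nil_semiring_V WA)); rewrite //= xi.
- apply: (reducible_iff _ (pair02 short xy0 hc0 xi yi)) => A WA.
  by rewrite wE; apply: (graph_satE short xy0 (nil_semiring_V WA)); rewrite //= xi yi.
Qed.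

(** * Consequences among the listed identities *)

Definition entails (W : set algebra) (r : seq clause * clause) : Prop :=
  forall A, W A -> (forall c, c \in r.1 -> sat A c) -> sat A r.2.

(** Consequences that follow from the laws of [nil_semiring] alone. One list serves both varieties,
    which is why it also mentions [c_gamma_1]. *)
Definition generic_rules : seq (seq clause * clause) :=
  [:: ([:: c_tau], c_chi); ([:: c_chi], c_s); ([:: c_chi], c_rho); ([:: c_chi], c_delta);
      ([:: c_s], c_beta); ([:: c_s], c_zeta); ([:: c_s], c_nu); ([:: c_beta], c_xi);
      ([:: c_beta], c_gamma_1); ([:: c_nu], c_gamma_1);
      ([:: c_delta], c_nu); ([:: c_nu], c_nu_D); ([:: c_nu], c_iota_2);
      ([:: c_nu_D], c_iota_2D); ([:: c_iota_2], c_iota_2D); ([:: c_iota_2D], c_mu_2);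
      ([:: c_rho], c_zeta); ([:: c_xi], c_zeta_D);
      ([:: c_zeta], c_zeta_D); ([:: c_zeta], c_omega); ([:: c_omega], c_eta);
      ([:: c_omega], c_omega_D); ([:: c_eta], c_eta_D); ([:: c_zeta_D], c_omega_D);
      ([:: c_omega_D], c_eta_D); ([:: c_eta_D], c_lambda);
      ([:: c_rho; c_xi], c_chi); ([:: c_omega; c_zeta_D], c_zeta);
      ([:: c_omega; c_nu_D], c_nu); ([:: c_omega; c_xi], c_s)].

Definition marked_rules : seq (seq clause * clause) :=
  [:: ([:: c_rho], c_delta); ([:: c_eta], c_iota_2); ([:: c_zeta], c_nu);
      ([:: c_lambda], c_mu_2); ([:: c_eta_D], c_iota_2D); ([:: c_zeta_D], c_nu_D)].

(** The instance of [mark_opp11] for a path of three edges. Each of [marked_rules] first bounds an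
    end of such a path and then applies it. *)
Definition c_marked : clause :=
  ([:: [:: 0]; [:: 0; 1]; [:: 1; 2]; [:: 2; 3]], [:: 0; 3]).

Lemma forall_in1 (T : eqType) (x : T) (P : T -> Prop) :
  (forall y, y \in [:: x] -> P y) -> P x.
Proof. by apply; exact: mem_head. Qed.

Lemma forall_in2 (T : eqType) (x y : T) (P : T -> Prop) :
  (forall z, z \in [:: x; y] -> P z) -> P x /\ P y.
Proof. by move=> h; split; apply: h; rewrite !inE eqxx ?orbT. Qed.

(* [use H l] closes a goal [_ <~ S] by the instance of [H : sat A c] at the
   values [l], up to commutativity of the products. *)
Ltac use HA H l :=
  match goal with v : nat -> _ |- _ => refine (H (nth (v 0) l) _ _) end;
  splits; try assumption; apply: (le_mulC HA); assumption.

Lemma Forall_in (T : eqType) (P : T -> Prop) s x : List.Forall P s -> x \in s -> P x.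
Proof. by elim=> // y s' Py _ IH; rewrite inE => /orP[/eqP->|/IH]. Qed.

Lemma generic_rules_sound (W : set algebra) : (forall A, W A -> nil_semiring A) ->
  forall r, r \in generic_rules -> entails W r.
Proof.
move=> HW r; apply: (@Forall_in _ (entails W)); do ![constructor] => A /HW HA; cbn [fst snd].
all: first [move/forall_in1 => h v S|
  move=> hh; have [h h'] := forall_in2 hh; move=> v S] => /=; repeat case=> ?.
all: move=> _.
- by refine (h (nth (v 0) [:: mul (v 0) (v 1); mul (v 0) (v 0)]) S _); splits.
- use HA h [:: v 0; v 1].
- apply: (le_sq HA (x := v 0)); use HA h [:: v 0; v 1].
- apply: (le_sq HA (x := v 0)); use HA h [:: v 0; v 1].
- apply: (le_sq HA (x := v 0)); use HA h [:: v 0; v 1].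
- apply: (le_sq HA (x := v 0)); use HA h [:: v 0; v 1].
- apply: (le_sq HA (x := v 0)); use HA h [:: v 0; v 1].
- use HA h [:: v 0; v 1; v 1; v 0].
- use HA h [:: v 0; v 2; v 1; v 3].
- use HA h [:: v 0; v 2; v 0; v 2; v 1; v 3].
- use HA h [:: v 2; v 3; v 4; v 5].
- use HA h [:: v 4; v 5; v 0; v 1; v 2; v 3].
- use HA h [:: v 0; v 2; v 1; v 0; v 2; v 3].
- use HA h [:: v 1; v 0; v 2; v 3; v 4; v 5].
- use HA h [:: v 0; v 1; v 2; v 3].
- use HA h [:: v 0; v 2; v 1; v 3; v 0; v 1].
- use HA h [:: v 2; v 3].
- apply: (le_sq HA (x := v 0)); use HA h [:: v 0; v 1].
- use HA h [:: v 0; v 1; v 2; v 3].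
- use HA h [:: v 0; v 1; v 1; v 0].
- have h1 : v 1 <~ S by use HA h [:: v 0; v 1].
  use HA h [:: v 1; v 2].
- use HA h [:: v 0; v 1].
- use HA h [:: v 0; v 1; v 2].
- use HA h [:: v 2; v 3; v 1; v 0].
- have h1 : v 1 <~ S by use HA h [:: v 0; v 1; v 3; v 4].
  use HA h [:: v 1; v 2; v 3; v 4].
- use HA h [:: v 1; v 0; v 2; v 0; v 1].
- have h0 : v 0 <~ S by use HA h [:: v 0; v 1].
  have h1 : v 1 <~ S by use HA h [:: v 1; v 0].
  use HA h' [:: v 0; v 1].
- have h1 : v 1 <~ S by use HA h [:: v 0; v 1].
  use HA h' [:: v 0; v 1; v 2; v 3].
- have h1 : v 1 <~ S by use HA h [:: v 0; v 1].
  use HA h' [:: v 2; v 3; v 4; v 5; v 0; v 1].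
- have h1 : v 1 <~ S by use HA h [:: v 0; v 1].
  use HA h' [:: v 0; v 1].
Qed.

Lemma marked_rules_sound (W : set algebra) : (forall A, W A -> nil_semiring A) ->
  (forall A, W A -> sat A c_marked) -> forall r, r \in marked_rules -> entails W r.
Proof.
move=> HW hW r; apply: (@Forall_in _ (entails W)); do ![constructor] => A WA.
all: have HA := HW _ WA; have hm := hW _ WA.
all: cbn [fst snd]; move/forall_in1 => h v S /=; repeat case=> ?; move=> _.
- have h0 : v 0 <~ S by use HA h [:: v 0; v 1].
  use HA hm [:: v 0; v 1; v 2; v 3].
- have h3 : v 3 <~ S by use HA h [:: v 0; v 2; v 3].
  by apply: (le_mulC HA); use HA hm [:: v 3; v 2; v 0; v 1].
- have h2 : v 2 <~ S by use HA h [:: v 0; v 1; v 2; v 3].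
  use HA hm [:: v 2; v 3; v 4; v 5].
- have h3 : v 3 <~ S by use HA h [:: v 1; v 0; v 3].
  by apply: (le_mulC HA); use HA hm [:: v 3; v 1; v 0; v 2].
- have h3 : v 3 <~ S by use HA h [:: v 0; v 2; v 3; v 4; v 5].
  by apply: (le_mulC HA); use HA hm [:: v 3; v 2; v 0; v 1].
- have h0 : v 0 <~ S by use HA h [:: v 4; v 5; v 0; v 1].
  use HA hm [:: v 0; v 1; v 2; v 3].
Qed.

Lemma marked11 A : V (R 1 1) A -> sat A c_marked.
Proof.
move=> WA; pose x := Var 0; pose y := Var 1; pose z := Var 2; pose u := Var 3.
apply/(@holds_le _ (nil_semiring_V WA) (Mul x u)
  (Add (Add (Add x (Mul x y)) (Mul y z)) (Mul z u)) [:: 0; 3] erefl).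
move/in_V: WA; apply=> v /=.
by case: (v 0); case: (v 1); case: (v 2); case: (v 3).
Qed.

Definition ids11 : seq identity :=
  [:: id_tau; id_chi; id_s; id_xi; id_beta; id_rho; id_zeta; id_omega; id_eta;
      id_lambda; id_zeta_D; id_omega_D; id_eta_D; id_delta; id_nu; id_nu_D;
      id_iota_2; id_iota_2D; id_mu_2].

Definition ids02 : seq identity :=
  [:: id_tau; id_chi; id_s; id_beta; id_delta; id_nu; id_gamma_1].

Lemma holds_normal_clause A : nil_semiring A ->
  List.Forall (fun e => holds A e <-> sat A (normal_clause (clause_of e)))
    (id_gamma_1 :: ids11).
Proof.
move=> HA; repeat first [exact: List.Forall_nil | apply: List.Forall_cons].
all: first [by apply: (holds_le HA); reflexivity | exact: (holds_sq HA) |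
  exact: (holds_trivial HA)].
Qed.

(* The last two edges of the path in the iota identities are redundant, since a
   marked vertex is adjacent to the whole opposite side. *)
Lemma iota_2_short A : V (R 1 1) A ->
  sat A (normal_clause (clause_of id_iota_2)) <-> sat A c_iota_2.
Proof.
move=> WA; have HA := nil_semiring_V WA; have hm := marked11 WA.
split=> h v S /=; repeat case=> ?; move=> _.
  (* The longer path goes back and forth along the edge from [v 0] to [v 2]. *)
  use HA h [:: v 0; v 1; v 2; v 0; v 2; v 3].
have h04 : mul (v 0) (v 4) <~ S by use HA hm [:: v 0; v 2; v 3; v 4].
use HA h [:: v 0; v 1; v 4; v 5].
Qed.

Lemma iota_2D_short A : V (R 1 1) A ->
  sat A (normal_clause (clause_of id_iota_2D)) <-> sat A c_iota_2D.
Proof.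
move=> WA; have HA := nil_semiring_V WA; have hm := marked11 WA.
split=> h v S /=; repeat case=> ?; move=> _.
  use HA h [:: v 0; v 1; v 2; v 0; v 2; v 3; v 4; v 5].
have h04 : mul (v 0) (v 4) <~ S by use HA hm [:: v 0; v 2; v 3; v 4].
use HA h [:: v 0; v 1; v 4; v 5; v 6; v 7].
Qed.

Lemma Forall_nth (T : Type) (P : T -> Prop) (x0 : T) s i :
  List.Forall P s -> i < size s -> P (nth x0 s i).
Proof. by move=> h; elim: h i => // x s' Px _ IH [|i] //= /IH. Qed.

Lemma holds11 A i : V (R 1 1) A -> i < size ids11 ->
  holds A (nth id_tau ids11 i) <-> sat A (nth c_tau clauses11 i).
Proof.
move=> WA i19; have HA := nil_semiring_V WA.
rewrite (@Forall_nth _ _ id_tau _ i.+1 (holds_normal_clause HA)) //.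
have [->|i16] := eqVneq i 16; first exact: iota_2_short.
have [->|i17] := eqVneq i 17; first exact: iota_2D_short.
have /allP/(_ i) : all (fun i => [|| i == 16, i == 17 |
    normal_clause (clause_of (nth id_tau ids11 i)) == nth c_tau clauses11 i]) (iota 0 19) by [].
by rewrite mem_iota (negbTE i16) (negbTE i17) => /(_ i19) /eqP <-.
Qed.

Lemma holds02 A i : V (R 0 2) A -> i < size ids02 ->
  holds A (nth id_tau ids02 i) <-> sat A (nth c_tau clauses02 i).
Proof.
move=> WA i7; have HA := nil_semiring_V WA.
have h k := @Forall_nth _ _ id_tau _ k (holds_normal_clause HA).
case: i i7 => [_|]; first exact: (h 1).
case=> [_|]; first exact: (h 2).
case=> [_|]; first exact: (h 3).
case=> [_|]; first exact: (h 5).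
case=> [_|]; first exact: (h 14).
case=> [_|]; first exact: (h 15).
by case=> // _; exact: (h 0).
Qed.

(** * Countermodels *)

Definition M_code (x : M) : nat :=
  match x with m0 => 0 | mc => 1 | mp => 2 | mq => 3 | ma => 4 | mb => 5 end.

Lemma M_code_inj : injective M_code.
Proof. by case=> -[]. Qed.

HB.instance Definition _ := Equality.copy M (inj_type M_code_inj).

(* Disjoint union of copies of M, the [k]-th one ordered as R_ij for
   [(i, j) = fl k], with the elements 0 and c of all copies identified; these
   two are represented in copy 0. *)
Definition elt : Type := (nat * M)%type.

Section Glue.
Variable fl : nat -> nat * nat.

Definition is_common (x : M) : bool := if x is (m0 | mc) then true else false.

Definition norm_elt (k : nat) (x : M) : elt := if x is (m0 | mc) then (0, x) else (k, x).

(** Vertices of different copies join to [mc] if both lie below it, and to the top otherwise. The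
    laws of the variety are not read off from this formula but inherited through [submodel_V]. *)
Definition addG (u v : elt) : elt :=
  let join k := joinM (fl k).1 (fl k).2 in
  match u, v with
  | (k, x), (l, y) =>
    if (k == l) || is_common y then norm_elt k (join k x y)
    else if is_common x then norm_elt l (join l x y)
    else if (join k x mc == mc) && (join l y mc == mc) then (0, mc) else (0, m0)
  end.

Definition mulG (u v : elt) : elt := if u.1 == v.1 then (0, mulM u.2 v.2) else (0, m0).

Definition glue : algebra := Algebra addG mulG (inhabits (0, m0)).

Definition closedG (l : seq elt) : bool :=
  ((0, m0) \in l) &&
  all (fun u => all (fun v => (addG u v \in l) && (mulG u v \in l)) l) l.

Lemma addG0 u : addG u (0, m0) = (0, m0).
Proof.
case: u => k x /=; rewrite orbT; case: (fl k) => i j.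
by case: x; rewrite /joinM /=; case: i => [|[|i]]; case: j => [|[|j]].
Qed.

Section Submodel.
Variables (l : seq elt) (lP : closedG l).

Lemma addG_closed (u v : {u : elt | u \in l}) : addG (val u) (val v) \in l.
Proof.
have /andP[_ /allP/(_ _ (valP u))/allP/(_ _ (valP v))/andP[]] := lP; done.
Qed.

Lemma mulG_closed (u v : {u : elt | u \in l}) : mulG (val u) (val v) \in l.
Proof.
have /andP[_ /allP/(_ _ (valP u))/allP/(_ _ (valP v))/andP[]] := lP; done.
Qed.

Lemma zero_closed : (0, m0) \in l.
Proof. by case/andP: lP. Qed.

Definition submodel : algebra :=
  @Algebra {u : elt | u \in l} (fun u v => exist (fun u : elt => u \in l) _ (addG_closed u v))
    (fun u v => exist (fun u : elt => u \in l) _ (mulG_closed u v))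
    (inhabits (exist (fun u : elt => u \in l) _ zero_closed)).

Definition leG (u v : elt) : bool := addG u v == v.

Definition word_max (w : word) : nat := foldr maxn 0 w.

(* Unlike [all], stops at the first failure under call by value. *)
Fixpoint every (T : Type) (p : T -> bool) (s : seq T) : bool :=
  if s is x :: s' then if p x then every p s' else false else true.

Lemma everyE (T : Type) (p : T -> bool) s : every p s = all p s.
Proof. by elim: s => //= x s ->; case: (p x). Qed.

(* Assigns the letters [size env], [size env + 1], ... in turn, and drops an
   assignment as soon as one of the premises [ws] is violated. *)
Fixpoint search (ws : seq word) (w : word) (z : elt) (n : nat) (env : seq elt) : bool :=
  if n is n'.+1 then
    every (fun u => let env' := rcons env u in
      if every (fun w' => if word_max w' == size env then
                            leG (wval (nth (0, m0) env' : nat -> glue) w') z else true) ws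
      then search ws w z n' env' else true) l
  else leG (wval (nth (0, m0) env : nat -> glue) w) z.

Definition decide (c : clause) : bool :=
  every (fun z => if z == (0, m0) then true else
    search c.1 c.2 z (word_max (flatten (c.2 :: c.1))).+1 [::]) l.

Lemma word_max_ge w i : i \in w -> i <= word_max w.
Proof.
elim: w => //= j w IH; rewrite inE => /orP[/eqP->|/IH iw]; first exact: leq_maxl.
exact: leq_trans iw (leq_maxr _ _).
Qed.

Lemma eq_wvalG (v v' : nat -> glue) w : w != [::] ->
  (forall i, i <= word_max w -> v i = v' i) -> wval v w = wval v' w.
Proof. by move=> w0 h; apply: eq_wval => // i /word_max_ge /h. Qed.

(** Only premises whose largest letter is still unassigned occur on the right: the others were
    tested when that letter got its value. *)
Lemma searchP ws w z n env : all (fun u => u != [::]) ws ->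
  search ws w z n env <->
  forall ext, size ext = n -> all (mem l) ext ->
    (forall w', w' \in ws -> size env <= word_max w' < size env + n ->
       leG (wval (nth (0, m0) (env ++ ext) : nat -> glue) w') z) ->
    leG (wval (nth (0, m0) (env ++ ext) : nat -> glue) w) z.
Proof.
move=> /allP ws0; elim: n env => [|n IH] env /=.
  split=> [h [|//] _ _ _|/(_ [::])]; first by rewrite cats0.
  by rewrite cats0; apply=> // w' _; rewrite addn0 leqNgt andNb.
have E u ext w' : w' \in ws -> word_max w' = size env ->
    wval (nth (0, m0) (rcons env u) : nat -> glue) w' =
    wval (nth (0, m0) (env ++ u :: ext) : nat -> glue) w'.
  move=> /ws0 w0 wm; apply: eq_wvalG => // i; rewrite wm => iw.
  by rewrite -cat_rcons nth_cat size_rcons ltnS iw.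
rewrite everyE; split=> [/allP h [//|u ext] [se] /= /andP[ul el] hw|h].
  have := h _ ul; rewrite -cat_rcons everyE; case: ifP => [_ /IH|/negP hn].
    apply=> // w' w'ws; rewrite size_rcons addSn cat_rcons => /andP[h1 h2].
    by apply: hw; rewrite // addnS h2 (ltnW h1).
  case: hn; apply/allP => w' w'ws; case: eqP => // wm.
  by rewrite (E u ext) // hw // wm leqnn addnS ltnS leq_addr.
apply/allP => u ul; rewrite everyE; case: ifP => // /allP hu; apply/IH => ext se el hw.
rewrite cat_rcons; apply: h => //=; [by rewrite se|by rewrite ul|].
move=> w' w'ws /andP[]; rewrite leq_eqVlt => /orP[/eqP wm _|h1 h2].
  by rewrite -(E u ext) //; have := hu _ w'ws; rewrite -wm eqxx.
by rewrite -cat_rcons; apply: hw => //; rewrite size_rcons h1 addSnnS.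
Qed.

Lemma val_wval (v : nat -> submodel) w :
  val (wval v w) = wval (val \o v : nat -> glue) w.
Proof. by elim: w => //= i [|j w] // IH; rewrite -IH. Qed.

Lemma le_submodel (u v : submodel) : u <~ v <-> leG (val u) (val v).
Proof. by split=> [h|/eqP h]; [apply/eqP; exact: (congr1 val h)|exact: val_inj]. Qed.

Lemma decideP c : all (fun u => u != [::]) (c.2 :: c.1) ->
  sat submodel c <-> decide c.
Proof.
case/andP=> w0 ws0; rewrite /decide everyE; set n := _.+1.
have wm w : w \in c.2 :: c.1 -> word_max w < n.
  move=> wc; rewrite ltnS; elim: w {w0 ws0} wc => // i w _ wc.
  have H u : {subset u <= flatten (c.2 :: c.1)} -> word_max u <= word_max (flatten (c.2 :: c.1)).
    elim: u => // j u IH sub /=; rewrite geq_max word_max_ge ?sub ?mem_head //.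
    by apply: IH => k ku; apply: sub; rewrite inE ku orbT.
  by apply: H => j jw; apply/flattenP; exists (i :: w).
split=> [h|/allP h v z hb].
  apply/allP => z zl; case: eqP => [//|z0]; apply/(searchP _ _ _ _ ws0) => ext se /allP el hw.
  pose v i : submodel := insubd (exist (fun u : elt => u \in l) _ zero_closed) (nth (0, m0) ext i).
  have vE (w : word) : w \in c.2 :: c.1 ->
      wval (nth (0, m0) ext : nat -> glue) w = val (wval v w).
    move=> wc; rewrite val_wval; apply: eq_wvalG => [|i iw].
      by move: wc; rewrite inE => /orP[/eqP->|/(allP ws0)].
    rewrite /= /v val_insubd ifT //; apply/el/mem_nth; rewrite se.
    exact: leq_ltn_trans iw (wm _ wc).
  have := h v (exist (fun u : elt => u \in l) z zl); rewrite le_submodel -vE ?mem_head //; apply.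
  apply/belowP => w' w'ws; apply/le_submodel; rewrite -vE ?inE ?w'ws ?orbT //.
  by apply: hw => //; apply: wm; rewrite inE w'ws orbT.
apply/le_submodel; have := h _ (valP z); case: eqP => [z0 _|_]; last move/(searchP _ _ _ _ ws0).
  by rewrite z0 /leG addG0.
move=> /(_ [seq val (v i) | i <- iota 0 n]).
have vE (w : word) : w \in c.2 :: c.1 ->
    wval (nth (0, m0) [seq val (v i) | i <- iota 0 n] : nat -> glue) w = val (wval v w).
  move=> wc; rewrite val_wval; apply: eq_wvalG => [|i iw].
    by move: wc; rewrite inE => /orP[/eqP->|/(allP ws0)].
  have iN := leq_ltn_trans iw (wm _ wc).
  by rewrite (nth_map 0) ?size_iota // nth_iota.
rewrite vE ?mem_head //; apply; first by rewrite size_map size_iota.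
  by apply/allP => _ /mapP[i _ ->]; exact: (valP (v i)).
move=> w' w'ws _; rewrite vE ?inE ?w'ws ?orbT //; apply/le_submodel.
by move/belowP: hb; apply.
Qed.

End Submodel.

(** * Membership of the countermodels in the variety *)

Definition triple : Type := (M * M * M)%type.

Section Membership.
Variables i j : nat.

Definition add3 (s t : triple) : triple :=
  (joinM i j s.1.1 t.1.1, joinM i j s.1.2 t.1.2, joinM i j s.2 t.2).

Definition mul3 (s t : triple) : triple :=
  (mulM s.1.1 t.1.1, mulM s.1.2 t.1.2, mulM s.2 t.2).

(* [rel] is a subalgebra of (R_ij)^3 together with a homomorphism to [glue]. *)
Definition hom_graph (rel : seq (triple * elt)) : bool :=
  uniq [seq p.1 | p <- rel] &&
  all (fun p => all (fun q => ((add3 p.1 q.1, addG p.2 q.2) \in rel) &&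
                              ((mul3 p.1 q.1, mulG p.2 q.2) \in rel)) rel) rel.

Definition saturate (n : nat) (gens : seq (triple * elt)) : seq (triple * elt) :=
  iter n (fun rel => foldl (fun r p => if p \in r then r else p :: r) rel
    ([seq (add3 p.1 q.1, addG p.2 q.2) | p <- rel, q <- rel] ++
     [seq (mul3 p.1 q.1, mulG p.2 q.2) | p <- rel, q <- rel])) gens.

(** Lift each letter to a triple related to its value. An identity of [R i j] holds in each
    coordinate, and as no triple occurs twice in [rel], equal triples have equal images. *)
Lemma submodel_V rel l (lP : closedG l) : hom_graph rel ->
  {subset l <= [seq p.2 | p <- rel]} -> V (R i j) (submodel lP).
Proof.
move=> /andP[un /allP cl] sub; apply/in_V => e he v.
have rep n : exists s, (s, val (v n)) \in rel.
  by have /sub/mapP[[s u] su /= ->] := valP (v n); exists s.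
have [r rP] := choice rep.
pose r1 n : R i j := (r n).1.1; pose r2 n : R i j := (r n).1.2; pose r3 n : R i j := (r n).2.
have evalP s : ((eval r1 s, eval r2 s, eval r3 s), val (eval v s)) \in rel.
  elim: s => [n|s IHs t IHt|s IHs t IHt] /=.
  - by have := rP n; rewrite /r1 /r2 /r3; case: (r n) => -[].
  - by have /allP/(_ _ IHt)/andP[] := cl _ IHs.
  - by have /allP/(_ _ IHt)/andP[] := cl _ IHs.
apply: val_inj; have := evalP e.1; have := evalP e.2; rewrite !he => p1 p2.
have inj p q : p \in rel -> q \in rel -> p.1 = q.1 -> p.2 = q.2.
  move=> pr qr pq; have ip : index p rel < size rel by rewrite index_mem.
  have iq : index q rel < size rel by rewrite index_mem.
  have : index p rel = index q rel.
    apply/eqP; rewrite -(nth_uniq p.1 _ _ un) ?size_map //.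
    by rewrite !(nth_map p) // !nth_index // pq.
  by move=> e'; rewrite -(nth_index p pr) e' nth_index.
exact: inj p2 p1 _.
Qed.

End Membership.
End Glue.

(** * The lattice of subvarieties *)

Section Lattice.
Variables (W : set algebra) (ids : seq identity).
Let N := size ids.
Let f i := nth id_tau ids i.

Definition all_hold (A : algebra) (G : seq nat) : Prop := forall i, i \in G -> holds A (f i).

(* [mods] lists the sets of identities of [ids] holding in the countermodels, and
   [closed] those holding in the rows of [T]. *)
Variables (rules : seq (seq nat * nat)) (mods closed : seq (seq nat)).
Variables (base : seq nat) (T : seq (seq nat * seq nat)) (d : nat) (dl : seq nat).

Definition one_pass (G : seq nat) : seq nat :=
  foldl (fun G r => if all (mem G) r.1 then if r.2 \in G then G else r.2 :: G else G)
    G rules.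

Definition rule_closure (k : nat) (G : seq nat) : seq nat := iter k one_pass G.

Definition row_indices : seq nat := iota 1 (size T).
Definition row_gens (n : nat) : seq nat := base ++ (nth ([::], [::]) T n.-1).1.
Definition row_closed (n : nat) : seq nat := nth [::] closed n.-1.
(* Row [n] is contained in row [m]. *)
Definition below_row (n m : nat) : bool := all (mem (row_closed n)) (row_gens m).
Definition row_covers (n : nat) : seq nat := (nth ([::], [::]) T n.-1).2.

(** Certifies [row_closed] from both sides: its members are derived by the rules, and every other
    index is refuted by a countermodel of the row. *)
Definition check_closed (k : nat) : bool :=
  all (fun n => [&& all (mem (rule_closure k (row_gens n))) (row_closed n),
    all (mem (row_closed n)) (row_gens n) &
    all (fun i => (i \in row_closed n) ||
        has (fun S => all (mem S) (row_gens n) && (i \notin S)) mods)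
      (iota 0 N)]) row_indices.

(** The rows contain the whole variety and are stable under adjoining one identity; by induction
    every subset of [ids] then defines a row. *)
Definition check_meets (k : nat) : bool :=
  has (fun n => nilp (nth ([::], [::]) T n.-1).1) row_indices &&
  all (fun n => all (fun i => (i \in row_closed n) || let G := rule_closure k (i :: row_closed n) in
    has (fun m => [&& i \in row_closed m, below_row m n & all (mem G) (row_gens m)]) row_indices)
    (iota 0 N)) row_indices.

Definition check_covers : bool :=
  all (fun n =>
    [&& all (fun m => [&& below_row m n, m != n, m \in row_indices &
          all (fun m' => (m == m') || ~~ below_row m m') (row_covers n)]) (row_covers n) &
        all (fun r => [|| ~~ below_row r n, r == n | has (below_row r) (row_covers n)]) row_indices])
    row_indices &&
  all (fun n => all (fun m => below_row n m && below_row m n ==> (n == m)) row_indices) row_indices.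

Definition check_index : bool :=
  [&& all (fun i => i < N) (base ++ flatten [seq r.1 | r <- T]), d < N &
      [seq n <- row_indices | d \in row_closed n] == dl].

Hypothesis W_variety : variety W.
Hypothesis W_reducible : forall e, exists2 G : seq nat, {subset G <= iota 0 N} &
  forall A, W A -> holds A e <-> all_hold A G.
Hypothesis rules_sound : forall r, r \in rules ->
  forall A, W A -> all_hold A r.1 -> holds A (f r.2).
Hypothesis mods_exist : forall S, S \in mods ->
  exists2 B, W B & forall i, i < N -> (i \in S) <-> holds B (f i).
Variables k k' : nat.
Hypothesis closedP : check_closed k.
Hypothesis meetsP : check_meets k'.
Hypothesis coversP : check_covers.
Hypothesis indexP : check_index.

Let table := [seq ([seq f i | i <- r.1], r.2) | r <- T].
Let W' := adjoin W [seq f i | i <- base].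

Lemma all_hold_cons A i G : all_hold A (i :: G) <-> holds A (f i) /\ all_hold A G.
Proof.
split=> [h|[hi hG] j]; last by rewrite inE => /orP[/eqP->|/hG].
by split=> [|j jG]; apply: h; rewrite inE ?eqxx ?jG ?orbT.
Qed.

Lemma all_hold_cat A G H : all_hold A (G ++ H) <-> all_hold A G /\ all_hold A H.
Proof.
split=> [h|[hG hH] j]; last by rewrite mem_cat => /orP[/hG|/hH].
by split=> j jG; apply: h; rewrite mem_cat jG ?orbT.
Qed.

Lemma rule_closure_sound n A G : W A -> all_hold A G -> all_hold A (rule_closure n G).
Proof.
move=> WA AG; elim: n => // n; rewrite /rule_closure iterS; set H := iter _ _ _.
rewrite /one_pass; have : {subset rules <= rules} by [].
elim: {1 3}rules H => //= r rs IH H rsub AH.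
apply: IH => [x xs|]; first by apply: rsub; rewrite inE xs orbT.
case: ifP => // /allP rH; case: ifP => // _; apply/all_hold_cons; split=> //.
by apply: (rules_sound _ WA) => [|i /rH /AH //]; apply: rsub; exact: mem_head.
Qed.

Lemma In_map (S : eqType) X (g : S -> X) s x :
  List.In x (map g s) <-> exists2 y, y \in s & x = g y.
Proof.
elim: s => [|y s IH] /=; first by split=> // -[].
rewrite IH; split=> [[<-|[z zs ->]]|[z]].
- by exists y; rewrite ?mem_head.
- by exists z; rewrite // inE zs orbT.
- by rewrite inE => /orP[/eqP->|zs] ->; [left|right; exists z].
Qed.

Lemma adjoinE (U : set algebra) G A :
  adjoin U [seq f i | i <- G] A <-> U A /\ all_hold A G.
Proof.
split=> [[UA h]|[UA h]]; split=> //.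
  by move=> i iG; apply: h; apply/In_map; exists i.
by move=> e /In_map[i iG ->]; exact: h.
Qed.

Lemma mem_rows n : n \in row_indices <-> row_numbers table n.
Proof. by rewrite mem_iota /row_numbers /= size_map add1n ltnS. Qed.

Lemma rowE n A : n \in row_indices -> row W' table n A <-> W A /\ all_hold A (row_gens n).
Proof.
rewrite mem_iota add1n => /andP[n0 nT]; rewrite /row /basis.
rewrite (nth_map ([::], [::])) /=; last by rewrite -ltnS prednK.
by rewrite adjoinE /W' adjoinE all_hold_cat; split=> [[[]]|[? []]].
Qed.

Lemma row_closed_sound n A : n \in row_indices -> W A ->
  all_hold A (row_gens n) <-> all_hold A (row_closed n).
Proof.
move=> nr WA; have /and3P[/allP h1 /allP h2 _] := allP closedP _ nr.
split=> [/(rule_closure_sound (n := k) WA) h i /h1 /h //|h i /h2 /h //].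
Qed.

Lemma gen_index n i : n \in row_indices -> i \in row_gens n -> i < N.
Proof.
rewrite mem_iota add1n => /andP[n0 nT] ig.
have /and3P[/allP h _ _] := indexP; apply: h; move: ig.
rewrite /row_gens !mem_cat => /orP[->//|iT]; apply/orP; right.
apply/flattenP; exists (nth ([::], [::]) T n.-1).1 => //.
by apply: map_f; apply: mem_nth; rewrite -ltnS prednK.
Qed.

Lemma row_closed_complete n i : n \in row_indices -> i < N ->
  (forall A, row W' table n A -> holds A (f i)) <-> i \in row_closed n.
Proof.
move=> nr iN; split=> [h|ic A /(rowE _ nr)[WA /(row_closed_sound nr WA)]]; last exact.
have /and3P[_ _ /allP/(_ i)] := allP closedP _ nr.
rewrite mem_iota => /(_ iN) /orP[//|/hasP[S Sm /andP[/allP SG nS]]].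
have [B WB BS] := mods_exist Sm.
case/negP: nS; apply/(BS _ iN)/h/(rowE _ nr); split=> // j jg.
by apply/BS/SG => //; exact: gen_index jg.
Qed.

Lemma row_sub n m : n \in row_indices -> m \in row_indices ->
  row W' table n `<=` row W' table m <-> below_row n m.
Proof.
move=> nr mr; split=> [h|/allP h A /(rowE _ nr)[WA /(row_closed_sound nr WA) An]].
  apply/allP => i ig; apply/(row_closed_complete nr (gen_index mr ig)) => A /h.
  by move=> /(rowE _ mr)[_]; apply.
by apply/(rowE _ mr); split=> // i /h /An.
Qed.

Lemma row_inj n m : n \in row_indices -> m \in row_indices ->
  row W' table n = row W' table m -> n = m.
Proof.
move=> nr mr e; have /andP[_ /allP/(_ _ nr)/allP/(_ _ mr)] := coversP.
have -> : below_row n m by apply/row_sub => //; rewrite e.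
have -> : below_row m n by apply/row_sub => //; rewrite e.
by move/eqP.
Qed.

Lemma W'_variety G : variety (adjoin W [seq f i | i <- G]).
Proof.
have [E ->] := W_variety.
exists (E `|` [set e | List.In e [seq f i | i <- G]]).
apply/seteqP; split=> A; first by case=> hE hG e [/hE|/hG].
by move=> h; split=> e he; apply: h; [left|right].
Qed.

Lemma row_Subv n : n \in row_indices -> Subv W' (row W' table n).
Proof.
move=> nr; split; last by move=> A [].
suff -> : row W' table n = adjoin W [seq f i | i <- row_gens n] by exact: W'_variety.
by apply/seteqP; split=> A; [move/(rowE _ nr)/adjoinE | move/adjoinE/(rowE _ nr)].
Qed.

Lemma meet_row G : {subset G <= iota 0 N} -> exists2 n, n \in row_indices &
  forall A, W A -> all_hold A (base ++ G) <-> all_hold A (row_gens n).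
Proof.
have /andP[/hasP[n0 n0r /nilP n0E] /allP hm] := meetsP.
elim: G => [|i G IH] sub.
  by exists n0 => // A _; rewrite /row_gens n0E.
have iN : i \in iota 0 N by apply: sub; exact: mem_head.
have [|n nr hn] := IH; first by move=> j jG; apply: sub; rewrite inE jG orbT.
have e A : W A -> all_hold A (base ++ i :: G) <-> holds A (f i) /\ all_hold A (row_gens n).
  move=> WA; rewrite -hn // !all_hold_cat all_hold_cons.
  by split=> [[? []]|[? []]].
have /allP/(_ _ iN)/orP[ic|/hasP[m mr /and3P[im mn /allP hG]]] := hm _ nr.
  exists n => // A WA; rewrite e //; split=> [[]//|h]; split=> //.
  by move/(row_closed_sound nr WA): h; apply.
exists m => // A WA; rewrite e //; split=> [[hi hg]|h].
  have : all_hold A (i :: row_closed n) by apply/all_hold_cons; split=> //; apply/row_closed_sound.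
  by move/(rule_closure_sound (n := k') WA) => h j /hG /h.
move/(row_closed_sound mr WA): h => h; split; first exact: h.
by move=> j jn; apply/h/(allP mn).
Qed.

(** Every identity reduces to listed ones, so [U] is cut out by the listed identities it satisfies,
    and these define a row. *)
Lemma Subv_row U : Subv W' U -> exists2 n, n \in row_indices & U = row W' table n.
Proof.
move=> [[E UE] UW'].
pose G := [seq i <- iota 0 N | `[< forall A, U A -> holds A (f i) >]].
have [|n nr hn] := @meet_row G; first by move=> i; rewrite mem_filter => /andP[].
exists n => //; apply/seteqP; split=> A.
  move=> UA; have /adjoinE[WA hb] := UW' _ UA; apply/(rowE _ nr); split=> //.
  apply/(hn _ WA)/all_hold_cat; split=> // i; rewrite mem_filter => /andP[/asboolP + _].
  exact.
move=> /(rowE _ nr)[WA /(hn _ WA)/all_hold_cat[_ hG]].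
rewrite UE => e Ee; have [I sub hI] := W_reducible e.
apply/(hI _ WA) => i iI; apply: hG; rewrite mem_filter sub // andbT.
apply/asboolP => B UB; have /adjoinE[WB _] := UW' _ UB.
by move: i iI; apply/(hI _ WB); rewrite UE in UB; exact: UB.
Qed.

Lemma row_bij : set_bij (row_numbers table) (Subv W') (row W' table).
Proof.
split=> [n /mem_rows/row_Subv //|n m|U /Subv_row[n nr ->]].
  by rewrite !inE => /mem_rows nr /mem_rows mr; exact: row_inj.
by exists n => //; apply/mem_rows.
Qed.

Lemma row_lower_cover n m : n \in row_indices -> m \in row_indices ->
  lower_cover W' (row W' table m) (row W' table n) <-> m \in row_covers n.
Proof.
move=> nr mr.
have /andP[/allP/(_ _ nr)/andP[/allP hcov /allP hbelow] _] := coversP.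
split=> [[_ _ [mn nm] hU]|mc].
  have /or3P[|/eqP mEn|/hasP[m' m'c mm']] := hbelow _ mr.
  - by move/negP; case; apply/row_sub.
  - by case: nm; rewrite mEn.
  have /and4P[m'n m'Dn m'r _] := hcov _ m'c.
  have [||/(row_inj m'r mr) <- //|/(row_inj m'r nr) m'En] :=
    hU _ (row_Subv m'r).
  - exact/row_sub.
  - exact/row_sub.
  by rewrite m'En eqxx in m'Dn.
have /and4P[mn mDn _ /allP anti] := hcov _ mc.
split; [exact: row_Subv|exact: row_Subv| |].
  split; first exact/row_sub.
  move=> nm; case/negP: mDn; apply/eqP/(row_inj mr nr)/seteqP; split=> //.
  exact/row_sub.
move=> _ /Subv_row[r rr ->] /(row_sub mr rr) mr' /(row_sub rr nr) rn.
have /or3P[/negP//|/eqP->|/hasP[m' m'c rm']] := hbelow _ rr; first by right.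
have /and4P[_ _ m'r _] := hcov _ m'c.
have mm' : below_row m m'.
  apply/(row_sub mr m'r); apply: (subset_trans (proj2 (row_sub mr rr) mr')).
  exact/row_sub.
have := anti _ m'c; rewrite mm' orbF => /eqP mE; left.
by apply/seteqP; split; apply/row_sub; rewrite // mE.
Qed.

Lemma lattice_describes : describes_Subv W' table.
Proof.
split=> [|n m /mem_rows nr /mem_rows mr]; first exact: row_bij.
rewrite row_lower_cover // /covers (nth_map ([::], [::])) //.
by move: nr; rewrite mem_iota add1n => /andP[n0 nT]; rewrite -ltnS prednK.
Qed.

Lemma card_seq (s : seq nat) : uniq s -> [set n | n \in s] #= `I_(size s).
Proof.
move=> us; apply/card_esym/card_set_bijP; exists (nth 0 s); split.
- by move=> i /= /mem_nth; exact.
- move=> i j; rewrite !inE => /= si sj /eqP.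
  by rewrite nth_uniq // => /eqP.
- by move=> n /= ns; exists (index n s); rewrite /= ?index_mem // nth_index.
Qed.

Lemma rowsE : row_numbers table = [set n | n \in row_indices].
Proof. by apply/seteqP; split=> n /mem_rows. Qed.

Lemma card_Subv : Subv W' #= `I_(size T).
Proof.
have [_ inj surj] := row_bij.
have -> : Subv W' = row W' table @` row_numbers table.
  apply/seteqP; split=> [U /surj //|U [n /mem_rows nr <-]]; exact: row_Subv.
apply: card_eq_trans (inj_card_eq inj) _.
by rewrite rowsE -[X in `I_X](size_iota 1); apply: card_seq; exact: iota_uniq.
Qed.

Lemma delta_rowsE : f d = id_delta -> delta_rows W' table = [set n | n \in dl].
Proof.
move=> fd; have /and3P[_ dN /eqP <-] := indexP.
apply/seteqP; split=> n; rewrite /delta_rows /= mem_filter.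
  by move=> [/mem_rows nr h]; rewrite nr andbT; apply/(row_closed_complete nr dN); rewrite fd.
move=> /andP[dc nr]; split; first exact/mem_rows.
by rewrite -fd => A; move/(row_closed_complete nr dN): dc; apply.
Qed.

Lemma card_delta : f d = id_delta ->
  [set U | Subv W' U /\ satisfies U id_delta] #= `I_(size dl).
Proof.
move=> fd; have [_ inj surj] := row_bij.
have -> : [set U | Subv W' U /\ satisfies U id_delta] = row W' table @` [set n | n \in dl].
  rewrite -(delta_rowsE fd); apply/seteqP; split=> [U [/surj[n nr <-] h]|U [n [nr h] <-]].
    by exists n.
  by split=> //; apply: row_Subv; exact/mem_rows.
apply: card_eq_trans (inj_card_eq _) _.
  move=> n m; rewrite !inE -(delta_rowsE fd) => -[nr _] [mr _]; apply: inj; exact/mem_set.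
have /and3P[_ _ /eqP <-] := indexP.
by apply: card_seq; rewrite filter_uniq // iota_uniq.
Qed.

Lemma lattice_conclusion : f d = id_delta ->
  [/\ Subv W' #= `I_(size T), describes_Subv W' table,
      [set U | Subv W' U /\ satisfies U id_delta] #= `I_(size dl) &
      delta_rows W' table = [set n | n \in dl]].
Proof.
move=> fd; split; [exact: card_Subv|exact: lattice_describes|exact: card_delta|].
exact: delta_rowsE.
Qed.

End Lattice.

Lemma adjoin_nil W : adjoin W [::] = W.
Proof. by apply/seteqP; split=> A; [case|move=> WA; split]. Qed.

(** * The three tables *)

Lemma reducible_holds i j cs :
  (forall t w, w != [::] -> reducible (V (R i j)) cs (fun A => sat A (words t, w))) ->
  forall e, reducible (V (R i j)) cs (fun A => holds A e).
Proof.
move=> h e.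
have h' t t' : reducible (V (R i j)) cs (fun A => forall w, w \in words t -> sat A (words t', w)).
  by apply: reducible_all => w /words_nonempty; exact: h.
apply: reducible_iff (reducible_and (h' e.1 e.2) (h' e.2 e.1)) => A /nil_semiring_V HA.
have E t t' : (forall w, w \in words t -> sat A (words t', w)) <->
    forall v : nat -> A, eval v t <~ eval v t'.
  split=> [hw v|hv w wt]; first by apply/(eval_le HA) => w /hw/(sat_words HA); exact.
  by apply/(sat_words HA) => v; have /(eval_le HA) := hv v; exact.
rewrite !E; split=> [he|[h1 h2] v]; last exact: le_anti.
by split=> v; rewrite he; exact: le_refl.
Qed.

Section Instance.
Variables (W : set algebra) (ids : seq identity) (cs : seq clause).
Hypothesis sizeE : size ids = size cs.
Hypothesis W_holds : forall A i, W A -> i < size ids ->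
  holds A (nth id_tau ids i) <-> sat A (nth c_tau cs i).
Hypothesis W_reduce : forall e, reducible W cs (fun A => holds A e).

Lemma reducible_index e : exists2 G : seq nat, {subset G <= iota 0 (size ids)} &
  forall A, W A -> holds A e <-> all_hold ids A G.
Proof.
have [ds dcs h] := W_reduce e; exists [seq index c cs | c <- ds].
  by move=> _ /mapP[c /dcs ccs ->]; rewrite mem_iota sizeE /= index_mem.
move=> A WA; rewrite h //; split=> [hd _ /mapP[c cd ->]|hi c cd].
  apply/W_holds => //; first by rewrite sizeE index_mem dcs.
  by rewrite nth_index ?dcs //; exact: hd.
have := hi _ (map_f (index ^~ cs) cd).
by move/(W_holds WA); rewrite sizeE index_mem dcs // nth_index ?dcs //; exact.
Qed.

(** Rules mentioning a clause outside [cs] are dropped, since such a clause would have no valid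
    index. *)
Definition coded_rules (rs : seq (seq clause * clause)) : seq (seq nat * nat) :=
  [seq ([seq index c cs | c <- r.1], index r.2 cs) |
    r <- [seq r <- rs | all (mem cs) (r.2 :: r.1)]].

Lemma coded_rules_sound rs : (forall r, r \in rs -> entails W r) ->
  forall r, r \in coded_rules rs -> forall A, W A -> all_hold ids A r.1 ->
    holds A (nth id_tau ids r.2).
Proof.
move=> hrs _ /mapP[r /[!mem_filter] /andP[/andP[r2 /allP r1] rrs] ->] A WA /= h.
apply/W_holds => //; first by rewrite sizeE index_mem.
have hr := hrs _ rrs; rewrite nth_index //; apply: (hr _ WA) => c cr.
have ccs : c \in cs := r1 _ cr.
have := h _ (map_f (index ^~ cs) cr); move/(W_holds WA).
by rewrite sizeE index_mem nth_index // ccs; exact.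
Qed.

Definition theory (fl : nat -> nat * nat) (l : seq elt) : seq nat :=
  [seq i <- iota 0 (size cs) | decide fl l (nth c_tau cs i)].

Lemma theoryP fl l (lP : closedG fl l) i :
  all (fun c => all (fun u : word => u != [::]) (c.2 :: c.1)) cs ->
  W (submodel lP) -> i < size ids ->
  i \in theory fl l <-> holds (submodel lP) (nth id_tau ids i).
Proof.
move=> /allP cs0 WB iN; rewrite W_holds // mem_filter mem_iota add0n -sizeE iN !andbT.
by apply: iff_sym; apply: decideP; apply: cs0; apply: mem_nth; rewrite -sizeE.
Qed.

End Instance.

Lemma theories_exist i j ids cs fl (rel : seq (triple * elt)) (models : seq (seq elt)) :
  size ids = size cs ->
  (forall A k, V (R i j) A -> k < size ids ->
     holds A (nth id_tau ids k) <-> sat A (nth c_tau cs k)) ->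
  all (fun c => all (fun u : word => u != [::]) (c.2 :: c.1)) cs ->
  hom_graph fl i j rel ->
  all (fun l => closedG fl l && all (mem [seq p.2 | p <- rel]) l) models ->
  forall S, S \in [seq theory cs fl l | l <- models] ->
  exists2 B, V (R i j) B & forall k, k < size ids -> k \in S <-> holds B (nth id_tau ids k).
Proof.
move=> sizeE hW cs0 hrel /allP hm _ /mapP[l /hm/andP[lP /allP lsub] ->].
have VB : V (R i j) (submodel lP) by refine (submodel_V lP hrel lsub).
by exists (submodel lP) => // k kN; apply: (theoryP sizeE hW).
Qed.

(** * Coded tables and concrete models *)

Fixpoint term_eqb (s t : term) : bool :=
  match s, t with
  | Var n, Var m => n == m
  | Add s1 s2, Add t1 t2 | Mul s1 s2, Mul t1 t2 => term_eqb s1 t1 && term_eqb s2 t2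
  | _, _ => false
  end.

(** A missing identity would get the invalid index [size ids]; [check_index] excludes this, and the
    final theorem checks that decoding gives back the tables. *)
Definition identity_code (ids : seq identity) (e : identity) : nat :=
  find (fun e' => term_eqb e.1 e'.1 && term_eqb e.2 e'.2) ids.

Definition code_table (ids : seq identity) (T : seq (seq identity * seq nat)) :=
  [seq ([seq identity_code ids e | e <- r.1], r.2) | r <- T].

Definition model (vs : seq elt) : seq elt := [:: (0, m0), (0, mc) & vs].

Definition vertices (k : nat) (xs : seq M) : seq elt := [seq (k, x) | x <- xs].

(* A homomorphism is given on a copy of M by the images of
   [a, p, b, q]. *)
Definition coord_image (h : seq (seq M)) (u : elt) : M :=
  nth m0 (nth [::] h u.1) (index u.2 [:: ma; mp; mb; mq]).

Definition generators (h1 h2 h3 : seq (seq M)) : seq (triple * elt) :=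
  [seq ((coord_image h1 u, coord_image h2 u, coord_image h3 u), u) |
    u <- [seq (k, x) | k <- iota 0 3, x <- [:: ma; mp; mb; mq]]].

Definition fl11 : nat -> nat * nat := nth (0, 0) [:: (1, 1); (0, 1); (0, 0)].
Definition fl02 : nat -> nat * nat := nth (0, 0) [:: (0, 2); (0, 2); (0, 0)].

(** The images are chosen so that vertices of different copies, as well as [mp] and [mq] of one
    copy, have product [m0] in some coordinate, and a vertex lies below [mc] in its copy exactly
    when all three images do. The same holds for [rel02]. *)
Definition rel11 : seq (triple * elt) := Eval vm_compute in
  saturate fl11 1 1 3 (generators
    [:: [:: ma; ma; mb; mb]; [:: mb; mb; ma; mp]; [:: mb; mb; mp; mp]]
    [:: [:: mb; mq; ma; mp]; [:: mb; mq; ma; mp]; [:: mb; mq; ma; mp]]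
    [:: [:: mb; mb; ma; ma]; [:: mq; mq; ma; ma]; [:: mp; mp; mb; mb]]).

Definition rel02 : seq (triple * elt) := Eval vm_compute in
  saturate fl02 0 2 3 (generators
    [:: [:: ma; mp; mb; mq]; [:: ma; mp; mb; mq]; [:: mb; mb; mp; mp]]
    [:: [:: mp; mp; mb; mb]; [:: ma; ma; mq; mq]; [:: mq; mq; ma; ma]]
    [:: [:: ma; ma; mq; mq]; [:: mp; mp; mb; mb]; [:: ma; mp; mb; mq]]).

Lemma rel11_hom : hom_graph fl11 1 1 rel11.
Proof. by vm_compute. Qed.

Lemma rel02_hom : hom_graph fl02 0 2 rel02.
Proof. by vm_compute. Qed.

Definition L01 : seq elt := vertices 1 [:: ma; mp; mb; mq].
Definition L00 : seq elt := vertices 2 [:: ma; mp; mb; mq].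
(** Under [fl11] these are the edges with both ends, one end (in two different copies) and no end
    below [mc]; under [fl02], [C_edge'] is again marked at one end. *)
Definition D_edge : seq elt := vertices 0 [:: ma; mb].
Definition C_edge : seq elt := vertices 0 [:: ma; mq].
Definition C_edge' : seq elt := vertices 1 [:: ma; mb].
Definition U_edge : seq elt := vertices 2 [:: ma; mb].

(** Premise graphs of listed identities: the path [L00] refutes [id_delta], [L01] refutes
    [id_iota_2], the whole copy 0 refutes [id_mu_2]; an additional marked edge serves the variants
    with C or D, such as [id_nu] and [id_nu_D]. *)
Definition models11 : seq (seq elt) := map model
  [:: [::]; U_edge; D_edge; C_edge; D_edge ++ U_edge; D_edge ++ C_edge';
      C_edge ++ C_edge'; vertices 1 [:: ma; mb; mq]; D_edge ++ vertices 1 [:: ma; mb; mq];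
      vertices 0 [:: ma; mp; mb]; L00; C_edge ++ L00; D_edge ++ L00; L01; D_edge ++ L01;
      vertices 0 [:: ma; mp; mb; mq]].

Definition models02 : seq (seq elt) := map model
  [:: [::]; U_edge; C_edge'; vertices 0 [:: ma; mb] ++ C_edge'; L00; C_edge' ++ L00;
      vertices 0 [:: ma; mp; mb; mq]].

Definition T01 := Eval vm_compute in code_table ids11 table01.
Definition T11 := Eval vm_compute in code_table ids11 table11.
Definition T02 := Eval vm_compute in code_table ids02 table02.
Definition rules11 := Eval vm_compute in coded_rules clauses11 (generic_rules ++ marked_rules).
Definition rules02 := Eval vm_compute in coded_rules clauses02 generic_rules.
Definition mods11 := Eval vm_compute in [seq theory clauses11 fl11 l | l <- models11].
Definition mods02 := Eval vm_compute in [seq theory clauses02 fl02 l | l <- models02].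
(** Twenty passes are generous fuel; the resulting lists are certified by [check_closed] with
    two. *)
Definition closures rules base (T : seq (seq nat * seq nat)) :=
  [seq rule_closure rules 20 (row_gens base T n) | n <- row_indices T].
Definition closed11 := Eval vm_compute in closures rules11 [::] T11.
Definition closed01 := Eval vm_compute in closures rules11 [:: 4] T01.
Definition closed02 := Eval vm_compute in closures rules02 [::] T02.

Lemma mods11E : mods11 = [seq theory clauses11 fl11 l | l <- models11].
Proof. by vm_compute. Qed.

Lemma mods02E : mods02 = [seq theory clauses02 fl02 l | l <- models02].
Proof. by vm_compute. Qed.

Lemma rules11_sound r : r \in rules11 -> forall A, V (R 1 1) A ->
  all_hold ids11 A r.1 -> holds A (nth id_tau ids11 r.2).
Proof.
have -> : rules11 = coded_rules clauses11 (generic_rules ++ marked_rules) by vm_compute.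
apply: coded_rules_sound => // [A i|]; first exact: holds11.
have HW A : V (R 1 1) A -> nil_semiring A by exact: nil_semiring_V.
move=> c; rewrite mem_cat => /orP[]; first exact: generic_rules_sound.
by apply: marked_rules_sound => // A; exact: marked11.
Qed.

Lemma rules02_sound r : r \in rules02 -> forall A, V (R 0 2) A ->
  all_hold ids02 A r.1 -> holds A (nth id_tau ids02 r.2).
Proof.
have -> : rules02 = coded_rules clauses02 generic_rules by vm_compute.
apply: coded_rules_sound => // [A i|]; first exact: holds02.
by apply: generic_rules_sound => A; exact: nil_semiring_V.
Qed.

Lemma mods11_exist S : S \in mods11 ->
  exists2 B, V (R 1 1) B & forall i, i < size ids11 -> i \in S <-> holds B (nth id_tau ids11 i).
Proof.
rewrite mods11E; apply: (theories_exist _ _ _ rel11_hom) => // A k; exact: holds11.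
Qed.

Lemma mods02_exist S : S \in mods02 ->
  exists2 B, V (R 0 2) B & forall i, i < size ids02 -> i \in S <-> holds B (nth id_tau ids02 i).
Proof.
rewrite mods02E; apply: (theories_exist _ _ _ rel02_hom) => // A k; exact: holds02.
Qed.

Lemma reducible_index11 e : exists2 G : seq nat, {subset G <= iota 0 (size ids11)} &
  forall A, V (R 1 1) A -> holds A e <-> all_hold ids11 A G.
Proof.
apply: (@reducible_index _ _ clauses11) => // [A i|]; first exact: holds11.
exact/reducible_holds/reduce11.
Qed.

Lemma reducible_index02 e : exists2 G : seq nat, {subset G <= iota 0 (size ids02)} &
  forall A, V (R 0 2) A -> holds A e <-> all_hold ids02 A G.
Proof.
apply: (@reducible_index _ _ clauses02) => // [A i|]; first exact: holds02.
exact/reducible_holds/reduce02.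
Qed.

(** * V(R_01) as a subvariety of V(R_11) *)

Section Morphism.
Variables (A B : algebra) (phi : A -> B).
Hypothesis phi_add : forall x y, phi (add x y) = add (phi x) (phi y).
Hypothesis phi_mul : forall x y, phi (mul x y) = mul (phi x) (phi y).

Lemma eval_morph (v : nat -> A) s : phi (eval v s) = eval (phi \o v) s.
Proof. by elim: s => //= s IHs t IHt; rewrite ?phi_add ?phi_mul IHs IHt. Qed.

Lemma holds_inj e : injective phi -> holds B e -> holds A e.
Proof. by move=> inj h v; apply: inj; rewrite !eval_morph. Qed.

Lemma holds_surj e : (forall y, exists x, phi x = y) -> holds A e -> holds B e.
Proof.
move=> surj h v; have [w wE] := choice (fun n => surj (v n)).
have -> : v = phi \o w by apply/funext => n /=.
by rewrite -!eval_morph h.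
Qed.

End Morphism.

Lemma L01_closed : closedG fl11 (model L01).
Proof. by vm_compute. Qed.

Lemma holds_R01 e : holds (R 0 1) e <-> holds (submodel L01_closed) e.
Proof.
have phiP x : norm_elt 1 x \in model L01 by case: x.
pose phi (x : R 0 1) : submodel L01_closed :=
  exist (fun u : elt => u \in model L01) _ (phiP x).
have phi_add x y : phi (add x y) = add (phi x) (phi y).
  by apply: val_inj; case: x; case: y.
have phi_mul x y : phi (mul x y) = mul (phi x) (phi y).
  by apply: val_inj; case: x; case: y.
split; [apply: (holds_surj phi_add phi_mul)|apply: (holds_inj phi_add phi_mul)].
  move=> [u ul]; exists u.2; apply: val_inj => /=.
  by move: ul; rewrite /model /L01 /vertices /= !inE; repeat case/orP => [/eqP->//|]; move/eqP->.
by move=> x y /(congr1 val); case: x; case: y.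
Qed.

(** Copy 1 of the glueing is R_01, and all listed identities true in it are derived by the rules
    from [id_beta], which has index 4; every other identity reduces to listed ones. *)
Lemma V_R01 : V (R 0 1) = adjoin (V (R 1 1)) [seq nth id_tau ids11 i | i <- [:: 4]].
Proof.
have VB : V (R 1 1) (submodel L01_closed).
  by refine (submodel_V L01_closed rel11_hom _); apply/allP; vm_compute.
have th i : i < size ids11 ->
    i \in theory clauses11 fl11 (model L01) <->
    holds (submodel L01_closed) (nth id_tau ids11 i).
  move=> iN; apply: (@theoryP (V (R 1 1))) => //.
  by move=> A k; exact: holds11.
apply/seteqP; split=> A.
  move/in_V => h; split.
    by apply/in_V => e he; apply/h/holds_R01; move/in_V: VB; exact.
  by move=> e /= [<-|//]; apply/h/holds_R01/(th 4).
move=> /adjoinE[WA A4]; apply/in_V => e /holds_R01 he.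
have [G sub hG] := reducible_index11 e; apply/(hG _ WA) => i iG.
have iN : i < size ids11 by have := sub _ iG; rewrite mem_iota.
have fi : i \in theory clauses11 fl11 (model L01).
  by apply/(th _ iN); have /(hG _ VB) := he; apply.
have h : {subset theory clauses11 fl11 (model L01) <= rule_closure rules11 20 [:: 4]}.
  by apply/allP; vm_compute.
have {A4} := @rule_closure_sound _ _ _ rules11_sound 20 _ _ WA A4.
move: (rule_closure _ _ _) h => G' h AG'; exact: AG' (h _ fi).
Qed.

Theorem theorem8p1 :
  [/\ Subv (V (R 0 1)) #= `I_11,
      Subv (V (R 0 2)) #= `I_11 &
      Subv (V (R 1 1)) #= `I_66] /\
  [/\ describes_Subv (V (R 0 1)) table01,
      describes_Subv (V (R 0 2)) table02 &
      describes_Subv (V (R 1 1)) table11] /\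
  [/\ [set U | Subv (V (R 0 1)) U /\ satisfies U id_delta] #= `I_5,
      [set U | Subv (V (R 0 2)) U /\ satisfies U id_delta] #= `I_5 &
      [set U | Subv (V (R 1 1)) U /\ satisfies U id_delta] #= `I_18] /\
  [/\ delta_rows (V (R 0 1)) table01 = [set n | n \in [:: 5; 7; 9; 10; 11]],
      delta_rows (V (R 0 2)) table02 = [set n | n \in [:: 6; 7; 9; 10; 11]] &
      delta_rows (V (R 1 1)) table11 =
        [set n | n \in [:: 18; 24; 31; 37; 38; 44; 45; 52; 53; 54; 56; 58;
                           60; 61; 62; 64; 65; 66]]].
Proof.
(* The indices of [id_delta] are 13 in [ids11] and 4 in [ids02]. Two passes of the rules close each
   row, and one pass suffices after adjoining an identity to a closed row. *)
have := lattice_conclusion (V_variety _) reducible_index11 rules11_sound mods11_exist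
  (k := 2) (k' := 1) (closed := closed11) (base := [::]) (T := T11) (d := 13)
  (dl := [:: 18; 24; 31; 37; 38; 44; 45; 52; 53; 54; 56; 58; 60; 61; 62; 64; 65; 66])
  isT isT isT isT erefl.
have := lattice_conclusion (V_variety _) reducible_index11 rules11_sound mods11_exist
  (k := 2) (k' := 1) (closed := closed01) (base := [:: 4]) (T := T01) (d := 13)
  (dl := [:: 5; 7; 9; 10; 11]) isT isT isT isT erefl.
have := lattice_conclusion (V_variety _) reducible_index02 rules02_sound mods02_exist
  (k := 2) (k' := 1) (closed := closed02) (base := [::]) (T := T02) (d := 4)
  (dl := [:: 6; 7; 9; 10; 11]) isT isT isT isT erefl.
rewrite -V_R01 !adjoin_nil.
have -> : [seq ([seq nth id_tau ids11 i | i <- r.1], r.2) | r <- T11] = table11 by [].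
have -> : [seq ([seq nth id_tau ids11 i | i <- r.1], r.2) | r <- T01] = table01 by [].
have -> : [seq ([seq nth id_tau ids02 i | i <- r.1], r.2) | r <- T02] = table02 by [].
by move=> [? ? ? ?] [? ? ? ?] [? ? ? ?]; split=> //; split=> //; split.
Qed.
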